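(* Let $p>3$ be an odd prime with $p\equiv 3 \pmod 4$. Then $$\sum_{m=1}^{p-1}\sum_{n=1}^{p-1}\left|C(m,n,5,1;p)\right|^4\cdot S^2(m\overline{n},p) = \frac{5}{48}p^5+O\!\left(p^4\exp\!\left(\frac{3\ln p}{\ln\ln p}\right)\right).$$
   Context: For a positive integer $q\ge 3$, integers $m,n$ and positive integers $k,h$, the two-term exponential sum is $C(m,n,k,h;q)=\sum_{a=0}^{q-1} e\!\left(\frac{ma^k+na^h}{q}\right)$, where $e(y)=e^{2\pi i y}$. For a positive integer $q$ and an integer $h$ coprime to $q$, the Dedekind sum is $S(h,q)=\sum_{a=0}^{q-1}\left(\left(\frac{a}{q}\right)\right)\left(\left(\frac{ah}{q}\right)\right)$, where $((x))=x-[x]-\frac12$ if $x$ is not an integer and $((x))=0$ if $x$ is an integer ($[x]$ the greatest integer $\le x$). For $n$ coprime to $p$, $\overline{n}$ denotes the inverse of $n$ modulo $p$. The implied constant in $O(\cdot)$ is absolute. *)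

(* Defs.v *)
From Stdlib Require Import Reals ZArith Znumtheory.
From Coquelicot Require Import Coquelicot.
Open Scope R_scope.

Definition ee (y : R) : C := (cos (2 * PI * y), sin (2 * PI * y)).

Definition Cexpsum (m n : Z) (k h q : nat) : C :=
  sum_n_m (G := C_AbelianMonoid)
    (fun a => ee ((IZR m * INR a ^ k + IZR n * INR a ^ h) / INR q)) 0 (q - 1).

(* ((x)) : x - [x] - 1/2 if x not an integer, 0 otherwise.
   Int_part x = up x - 1 is the floor of x. *)
Definition saw (x : R) : R :=
  if Req_EM_T x (IZR (Int_part x)) then 0
  else x - IZR (Int_part x) - 1 / 2.

Definition dedekind (h : Z) (q : nat) : R :=
  sum_n_m (G := R_AbelianMonoid)
    (fun a => saw (INR a / INR q) * saw (INR a * IZR h / INR q)) 0 (q - 1).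

(* Main.v *)
Require Import Defs.
From Stdlib Require Import Reals ZArith Znumtheory Lra Lia.
From Coquelicot Require Import Coquelicot.
From HB Require Import structures.
From mathcomp Require all_boot all_algebra zify ring finfield.
Open Scope R_scope.

(* With r = m / n the double sum is the sum over r <> 0 of S(r)^2 F(r), where
   F(r) = sum_n C(rn, n)^4 (C is real, since a -> -a conjugates it).  Rescaling the
   summation variable shows F(r t^4) = F(r), and for p = 3 mod 4 every residue
   is +- a fourth power; so F(r) + F(-r) is constant, and since S^2 is even the
   sum factors as (sum S^2) (sum F) / (p - 1).

   sum F: orthogonality reduces the full fourth moment to counting
   a + b + c + d = 0 = a^5 + b^5 + c^5 + d^5, that is xyz(x^2 + y^2 + z^2) = 0
   with x = a + b, y = b + c, z = c + a.  Each of the four factors vanishes at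
   exactly p^2 points, which gives 4 p^4 + O(p^3); the term m = n = 0 removes p^4.

   sum S^2: with w(a) = (pi/p) cot(pi a/p) ~ 1/a, finite Fourier analysis turns
   it into p^2 / (2 pi^4) times the sum of +- w(a) w(b) w(c) w(d) over
   1 <= a, b, c, d < p/2 with ad = +- bc mod p.  The solutions ad = bc in integers
   contribute zeta(2)^4 / zeta(4) = 5 pi^4 / 72; the other ones have max(ad, bc) >= p/2
   and are controlled by the divisor bound
   d(n) <= exp((2 ln 2 + o(1)) ln n / ln ln n). *)

(** The exponents 5 and 1 are what produce fourth powers: a -> a s sends (m, n) to (m s^5, n s),
    hence m / n to (m / n) s^4. The obstacle is that S(r)^2 and F(r) are multiplied pointwise while
    only their averages are accessible; pairing r with -r removes the correlation. The constant is 3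
    * 5 / 144 = 5 / 48. The fourth moment is 3 p^4 with relative error O(1 / p), and the sum of S^2
    is 5 p^2 / 144 with relative error O(D (ln p)^3 / p), where D bounds the divisor function below
    p^2. Only the second error produces the exponential factor. As ln n < 2 ln p in that range, the
    divisor bound costs 4 ln 2 < 2.88 in units of ln p / ln ln p; the gap up to 3 absorbs the powers
    of ln p and the contribution of the small primes. Characters are handled as a pair of real
    functions, cosine and sine, on 'F_p, so that every estimate concerns real sums. *)

Module DedekindMoment.
Import all_boot all_algebra zify.
Import GRing.Theory.
Set Implicit Arguments. Unset Strict Implicit. Unset Printing Implicit Defensive.
Delimit Scope R_scope with Re.
Delimit Scope Z_scope with Z.
Open Scope R_scope.

(** * Finite sums of reals *)

HB.instance Definition _ := Monoid.isComLaw.Build R 0 Rplus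
  (fun x y z => esym (Rplus_assoc x y z)) Rplus_comm Rplus_0_l.
HB.instance Definition _ := Monoid.isMulLaw.Build R 0 Rmult Rmult_0_l Rmult_0_r.
HB.instance Definition _ :=
  Monoid.isAddLaw.Build R Rmult Rplus Rmult_plus_distr_r Rmult_plus_distr_l.

Reserved Notation "\rsum_ ( i <- r | P ) F"
  (at level 36, F at level 36, i, r at level 50).
Reserved Notation "\rsum_ ( i <- r ) F"
  (at level 36, F at level 36, i, r at level 50).
Reserved Notation "\rsum_ ( m <= i < n ) F"
  (at level 36, F at level 36, i, m, n at level 50).
Reserved Notation "\rsum_ ( i | P ) F" (at level 36, F at level 36, i at level 50).
Reserved Notation "\rsum_ ( i : t | P ) F"
  (at level 36, F at level 36, i at level 50).
Reserved Notation "\rsum_ ( i : t ) F" (at level 36, F at level 36, i at level 50).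
Reserved Notation "\rsum_ i F"
  (at level 36, F at level 36, i at level 0, right associativity).

Notation "\rsum_ ( i <- r | P ) F" := (\big[Rplus/0%Re]_(i <- r | P%B) F%Re) : R_scope.
Notation "\rsum_ ( i <- r ) F" := (\big[Rplus/0%Re]_(i <- r) F%Re) : R_scope.
Notation "\rsum_ ( m <= i < n ) F" := (\big[Rplus/0%Re]_(m <= i < n) F%Re) : R_scope.
Notation "\rsum_ ( i | P ) F" := (\big[Rplus/0%Re]_(i | P%B) F%Re) : R_scope.
Notation "\rsum_ ( i : t | P ) F" := (\big[Rplus/0%Re]_(i : t | P%B) F%Re) : R_scope.
Notation "\rsum_ ( i : t ) F" := (\big[Rplus/0%Re]_(i : t) F%Re) : R_scope.
Notation "\rsum_ i F" := (\big[Rplus/0%Re]_i F%Re) : R_scope.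

Definition ind (b : bool) : R := if b then 1 else 0.

Lemma ind_ge0 b : 0 <= ind b. Proof. by case: b => /=; lra. Qed.
Lemma ind_le1 b : ind b <= 1. Proof. by case: b => /=; lra. Qed.

Section Sums.
Variables (I : Type) (r : seq I) (P : pred I).
Implicit Types F G : I -> R.

Lemma rsum_le F G : (forall i, P i -> F i <= G i) ->
  \rsum_(i <- r | P i) F i <= \rsum_(i <- r | P i) G i.
Proof. by move=> H; elim/big_ind2: _ => // [|*]; lra. Qed.

Lemma rsum_ge0 F : (forall i, P i -> 0 <= F i) -> 0 <= \rsum_(i <- r | P i) F i.
Proof. by move=> H; elim/big_ind: _ => // [|*]; lra. Qed.

Lemma rsum_mulr c F :
  \rsum_(i <- r | P i) (F i * c) = (\rsum_(i <- r | P i) F i) * c.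
Proof. by rewrite -(@big_distrl _ _ Rmult Rplus). Qed.

Lemma rsum_mull c F :
  \rsum_(i <- r | P i) (c * F i) = c * (\rsum_(i <- r | P i) F i).
Proof. by rewrite -(@big_distrr _ _ Rmult Rplus). Qed.

Lemma rsum_add F G :
  \rsum_(i <- r | P i) (F i + G i) =
  \rsum_(i <- r | P i) F i + \rsum_(i <- r | P i) G i.
Proof. exact: big_split. Qed.

Lemma rsum_opp F : \rsum_(i <- r | P i) - F i = - \rsum_(i <- r | P i) F i.
Proof.
by elim/big_rec2: _ => [|i x y _ ->]; [rewrite Ropp_0 | rewrite Ropp_plus_distr].
Qed.

Lemma rsum_sub F G :
  \rsum_(i <- r | P i) (F i - G i) =
  \rsum_(i <- r | P i) F i - \rsum_(i <- r | P i) G i.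
Proof. by rewrite /Rminus -rsum_opp -rsum_add. Qed.

Lemma rsum_abs F :
  Rabs (\rsum_(i <- r | P i) F i) <= \rsum_(i <- r | P i) Rabs (F i).
Proof.
elim/big_rec2: _ => [|i x y _ H]; first by rewrite Rabs_R0; lra.
by have := Rabs_triang (F i) y; lra.
Qed.

Lemma rsum0 F : (forall i, P i -> F i = 0) -> \rsum_(i <- r | P i) F i = 0.
Proof. exact: big1. Qed.

Lemma rsum_ind F : \rsum_(i <- r | P i) F i = \rsum_(i <- r) (ind (P i) * F i).
Proof. by rewrite big_mkcond; apply: eq_bigr => i _; case: (P i) => /=; ring. Qed.

End Sums.

Lemma rsum_const (T : finType) (P : pred T) c : \rsum_(i | P i) c = INR #|P| * c.
Proof.
rewrite big_const; elim: #|P| => [|n IH]; first by rewrite /=; ring.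
by rewrite iterS IH S_INR; ring.
Qed.

Lemma rsum_delta (T : finType) (x : T) F : \rsum_i (ind (i == x) * F i) = F x.
Proof. by rewrite -rsum_ind big_pred1_eq. Qed.

Lemma rsum_delta' (T : finType) (x : T) F : \rsum_i (ind (x == i) * F i) = F x.
Proof. by rewrite -[RHS]rsum_delta; apply: eq_bigr => i _; rewrite eq_sym. Qed.

Lemma rsum_nat_le (m n : nat) (F G : nat -> R) :
  (forall i, (m <= i < n)%N -> F i <= G i) ->
  \rsum_(m <= i < n) F i <= \rsum_(m <= i < n) G i.
Proof. by move=> H; rewrite big_nat [X in _ <= X]big_nat; apply: rsum_le. Qed.

Lemma rsum_nat_const (m n : nat) c : \rsum_(m <= i < n) c = INR (n - m) * c.
Proof.
rewrite big_const_nat; elim: (n - m)%N => [|k IH]; first by rewrite /=; ring.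
by rewrite iterS IH S_INR; ring.
Qed.

Lemma sum_n_m_rsum (f : nat -> R) a b : (a <= b)%N ->
  sum_n_m (G := R_AbelianMonoid) f a b = \rsum_(a <= i < b.+1) f i.
Proof.
elim: b => [|b IH] ab.
  by move: ab; rewrite leqn0 => /eqP ->; rewrite sum_n_n big_nat1.
move: ab; rewrite leq_eqVlt => /orP [/eqP -> | ab].
  by rewrite sum_n_n big_nat1.
rewrite sum_n_Sm; last by apply: le_S; apply/leP.
by rewrite IH // [RHS]big_nat_recr //; apply: ltnW.
Qed.

(** * Additive characters of F_p *)

Section CharactersFp.
Variable p : nat.
Hypothesis p_pr : prime p.
Local Notation F := 'F_p.

Lemma INR_p_gt0 : 0 < INR p.
Proof. by apply: lt_0_INR; apply/ltP; apply: prime_gt0. Qed.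

Lemma ltn_Fp (x : F) : (x < p)%N.
Proof. by have := ltn_ord x; rewrite [X in (_ < X)%N](Fp_cast p_pr). Qed.

Lemma natr_Fp (x : F) : ((x : nat)%:R : F)%R = x.
Proof. exact: natr_Zp. Qed.

Lemma val_natr_Fp (n : nat) : ((n%:R : F)%R : nat) = (n %% p)%N.
Proof. exact: val_Fp_nat. Qed.

Lemma eq_natr_Fp (m n : nat) : ((m%:R : F) == (n%:R : F))%R = (m == n %[mod p])%N.
Proof. by rewrite -val_eqE /= !val_natr_Fp. Qed.

Lemma rsum_Fp (f : nat -> R) : \rsum_(0 <= i < p) f i = \rsum_(x : F) f x.
Proof. by rewrite -[in LHS](Fp_cast p_pr) big_mkord. Qed.

(** Real and imaginary parts of the additive character e(x / p), taken at the representative of x in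
    [0, p). Complex numbers are thereby confined to the final comparison with [Cexpsum]. *)
Definition cs (x : F) : R := cos (2 * PI * INR x / INR p).
Definition sn (x : F) : R := sin (2 * PI * INR x / INR p).

Lemma cs_natr (n : nat) : cs n%:R%R = cos (2 * PI * INR n / INR p).
Proof.
rewrite /cs val_natr_Fp [in RHS](divn_eq n p) plus_INR mult_INR.
have -> : 2 * PI * (INR (n %/ p) * INR p + INR (n %% p)) / INR p =
  2 * PI * INR (n %% p) / INR p + 2 * INR (n %/ p) * PI.
  by field; have := INR_p_gt0; lra.
by rewrite cos_period.
Qed.

Lemma sn_natr (n : nat) : sn n%:R%R = sin (2 * PI * INR n / INR p).
Proof.
rewrite /sn val_natr_Fp [in RHS](divn_eq n p) plus_INR mult_INR.
have -> : 2 * PI * (INR (n %/ p) * INR p + INR (n %% p)) / INR p =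
  2 * PI * INR (n %% p) / INR p + 2 * INR (n %/ p) * PI.
  by field; have := INR_p_gt0; lra.
by rewrite sin_period.
Qed.

Lemma csD (x y : F) : cs (x + y)%R = cs x * cs y - sn x * sn y.
Proof.
rewrite -(natr_Fp x) -(natr_Fp y) -natrD !cs_natr !sn_natr -cos_plus plus_INR.
by congr cos; field; have := INR_p_gt0; lra.
Qed.

Lemma snD (x y : F) : sn (x + y)%R = sn x * cs y + cs x * sn y.
Proof.
rewrite -(natr_Fp x) -(natr_Fp y) -natrD !cs_natr !sn_natr -sin_plus plus_INR.
by congr sin; field; have := INR_p_gt0; lra.
Qed.

Lemma cs0 : cs 0%R = 1.
Proof. by rewrite -[0%R]/(0%:R : F)%R cs_natr /= Rmult_0_r /Rdiv Rmult_0_l cos_0. Qed.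

Lemma sn0 : sn 0%R = 0.
Proof. by rewrite -[0%R]/(0%:R : F)%R sn_natr /= Rmult_0_r /Rdiv Rmult_0_l sin_0. Qed.

Lemma cs2_sn2 x : cs x * cs x + sn x * sn x = 1.
Proof. by have := sin2_cos2 (2 * PI * INR x / INR p); rewrite /Rsqr /cs /sn; lra. Qed.

(** The addition formulas at x + (-x) = 0 form a linear system for the two values at -x, with
    determinant 1 by [cs2_sn2]; the representative of -x is never computed. *)
Lemma csN (x : F) : cs (- x)%R = cs x.
Proof.
have := csD x (- x)%R; have := snD x (- x)%R; rewrite subrr cs0 sn0.
have := cs2_sn2 x; move: (cs x) (sn x) (cs (-x)%R) (sn (-x)%R) => c s c' s' h h1 h2.
have : c' * (c * c + s * s) = c * (c * c' - s * s') + s * (s * c' + c * s') by ring.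
by rewrite h -h1 -h2; lra.
Qed.

Lemma snN (x : F) : sn (- x)%R = - sn x.
Proof.
have := csD x (- x)%R; have := snD x (- x)%R; rewrite subrr cs0 sn0 csN.
have := cs2_sn2 x; move: (cs x) (sn x) (sn (-x)%R) => c s s' h h1 h2.
have : s' * (c * c + s * s) = c * (s * c + c * s') - s * (c * c - s * s') by ring.
by rewrite h -h1 -h2; lra.
Qed.

Lemma cs_neq1 (x : F) : x != 0%R -> cs x < 1.
Proof.
move=> x0; have px := ltn_Fp x.
have x1 : (0 < x)%N by rewrite lt0n.
have p0 := INR_p_gt0; have pi0 := PI_RGT_0.
have xp : INR x < INR p by apply: lt_INR; apply/ltP.
have x2 : 0 < INR x by apply: lt_0_INR; apply/ltP.
have a0 : 0 < PI * (INR x / INR p) by apply: Rmult_lt_0_compat => //; apply: Rdiv_lt_0_compat.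
have a1 : PI * (INR x / INR p) < PI.
  rewrite -[X in _ < X]Rmult_1_r; apply: Rmult_lt_compat_l => //.
  by apply/Rlt_div_l => //; lra.
rewrite /cs; have -> : 2 * PI * INR x / INR p = 2 * (PI * (INR x / INR p)) by field; lra.
rewrite cos_2a_sin; have := sin_gt_0 _ a0 a1; nra.
Qed.

(** For k <> 0 the shift x -> x + 1 rotates the vector (A, B) of cosine and sine sums by the angle
    of k. A rotation whose cosine is less than 1 fixes only the zero vector. *)
Lemma cs_orth (k : F) : \rsum_(x : F) cs (k * x)%R = INR p * ind (k == 0%R).
Proof.
case: eqP => [->|/eqP k0].
  under eq_bigr => x _ do rewrite mul0r cs0.
  by rewrite rsum_const card_Fp //=.
set A := \rsum_(x : F) _; pose B := \rsum_(x : F) sn (k * x)%R.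
have hA : A = A * cs k - B * sn k.
  rewrite {1}/A (reindex_inj (addIr 1%R)) /= /A /B -!rsum_mulr -rsum_sub.
  by apply: eq_bigr => x _; rewrite mulrDr mulr1 csD.
have hB : B = B * cs k + A * sn k.
  rewrite {1}/B (reindex_inj (addIr 1%R)) /= /A /B -!rsum_mulr -rsum_add.
  by apply: eq_bigr => x _; rewrite mulrDr mulr1 snD.
have := cs_neq1 k0; move: (cs k) (sn k) hA hB => c s hA hB c1.
have : A * ((1 - c) * (1 - c) + s * s) = 0.
  have e1 : A * (1 - c) = - B * s by lra.
  have e2 : B * (1 - c) = A * s by lra.
  have -> : A * ((1 - c) * (1 - c) + s * s) = (A * (1 - c)) * (1 - c) + A * s * s by ring.
  by rewrite e1 -e2; ring.
by move=> h; rewrite /= Rmult_0_r; case: (Rmult_integral _ _ h) => // h'; nra.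
Qed.

Lemma rsum_odd (f : F -> R) : (forall x, f (- x)%R = - f x) -> \rsum_x f x = 0.
Proof.
move=> h; have : \rsum_x f x = - \rsum_x f x; last lra.
by rewrite {1}(reindex_inj oppr_inj) -rsum_opp; apply: eq_bigr.
Qed.

Lemma sn_orth (k : F) : \rsum_(x : F) sn (k * x)%R = 0.
Proof. by apply: rsum_odd => x; rewrite mulrN snN. Qed.

End CharactersFp.

(** * The fourth moment as a point count *)

Module FpIdentities.
Import mathcomp.algebra_tactics.ring.

(** With d = -(a + b + c), if two variables cancel then so do the other two and the sum vanishes;
    hence the three linear factors. [sum_squares_pairs] diagonalises the remaining quadratic factor
    in the pair sums. *)
Lemma sum_fifth_powers (T : comRingType) (a b c : T) :
  (a ^+ 5 + b ^+ 5 + c ^+ 5 + (- (a + b + c)) ^+ 5 =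
   - (5%:R * ((a + b) * (b + c) * (c + a) *
      (a ^+ 2 + b ^+ 2 + c ^+ 2 + a * b + b * c + c * a))))%R.
Proof. ring. Qed.

Lemma sum_squares_pairs (T : comRingType) (a b c : T) :
  (2%:R * (a ^+ 2 + b ^+ 2 + c ^+ 2 + a * b + b * c + c * a) =
   (a + b) ^+ 2 + (b + c) ^+ 2 + (c + a) ^+ 2)%R.
Proof. ring. Qed.

Lemma phase_rescale (T : comRingType) (m n s a : T) :
  (m * (a * s) ^+ 5 + n * (a * s) = m * s ^+ 5 * a ^+ 5 + n * s * a)%R.
Proof. ring. Qed.

Lemma phase_sum (T : comRingType) (m n a b c d : T) :
  (m * d ^+ 5 + n * d + (m * c ^+ 5 + n * c + (m * b ^+ 5 + n * b + (m * a ^+ 5 + n * a))) =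
   m * (a ^+ 5 + b ^+ 5 + c ^+ 5 + d ^+ 5) + n * (a + b + c + d))%R.
Proof. ring. Qed.

Lemma phase_orbit (T : comRingType) (r t s n : T) : (t * s = 1)%R ->
  (r * t ^+ 4 * n * s ^+ 5 = r * (n * s))%R.
Proof.
move=> h; have -> : (r * t ^+ 4 * n * s ^+ 5 = r * (n * s) * (t * s) ^+ 4)%R by ring.
by rewrite h expr1n mulr1.
Qed.

Lemma shift_pairs (T : fieldType) (x y z : T) : (2%:R != 0 :> T)%R ->
  ((z - x + y) / 2%:R + x - (y - (z - x + y) / 2%:R) = z)%R.
Proof. by move=> h; field. Qed.
End FpIdentities.

Section Moment.
Variable p : nat.
Hypothesis p_pr : prime p.
Local Notation F := 'F_p.

(** The value of C(m, n, 5, 1; p), whose sine part vanishes because the phase is odd in a. *)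
Definition A (m n : F) : R := \rsum_(a : F) cs (m * a ^+ 5 + n * a)%R.

(** An odd phase has zero sine sum, so the addition formula loses its sine term and a product of
    cosine sums becomes a single cosine sum. Iterating this expands [A m n ^ 4]. *)
Lemma rsum_cs_shift (g : F -> F) (th : F) : (forall a, g (- a)%R = - g a)%R ->
  (\rsum_a cs (g a)) * cs th = \rsum_a cs (g a + th)%R.
Proof.
move=> g_odd; have h : \rsum_a sn (g a) = 0 by apply: rsum_odd => x; rewrite g_odd snN.
transitivity ((\rsum_a cs (g a)) * cs th - (\rsum_a sn (g a)) * sn th); first by rewrite h; ring.
by rewrite -!rsum_mulr -rsum_sub; apply: eq_bigr => a _; rewrite csD.
Qed.

Lemma phase_odd (m n a : F) :
  (m * (- a) ^+ 5 + n * - a = - (m * a ^+ 5 + n * a))%R.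
Proof. by rewrite exprNn -signr_odd expr1 mulN1r !mulrN opprD. Qed.

Lemma A_pow4 m n : A m n ^ 4 =
  \rsum_(a : F) \rsum_(b : F) \rsum_(c : F) \rsum_(d : F)
    cs (m * (a ^+ 5 + b ^+ 5 + c ^+ 5 + d ^+ 5) + n * (a + b + c + d))%R.
Proof.
pose g a : F := (m * a ^+ 5 + n * a)%R.
have gN a : g (- a)%R = (- g a)%R by apply: phase_odd.
have -> : A m n = \rsum_a cs (g a) by [].
set S := \rsum_a cs (g a).
transitivity (S * S * S * S); first by ring.
rewrite {1}/S -!rsum_mulr; apply: eq_bigr => a _.
rewrite [cs _ * _]Rmult_comm (rsum_cs_shift _ gN) -!rsum_mulr; apply: eq_bigr => b _.
rewrite [cs _ * _]Rmult_comm (rsum_cs_shift _ gN) -!rsum_mulr; apply: eq_bigr => c _.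
rewrite [cs _ * _]Rmult_comm (rsum_cs_shift _ gN); apply: eq_bigr => d _.
by congr cs; rewrite /g FpIdentities.phase_sum.
Qed.

Lemma cs_orth2 (u v : F) : \rsum_(m : F) \rsum_(n : F) cs (m * u + n * v)%R =
  INR p ^ 2 * (ind (u == 0%R) * ind (v == 0%R)).
Proof.
transitivity ((\rsum_(m : F) cs (u * m)%R) * (\rsum_(n : F) cs (v * n)%R) -
              (\rsum_(m : F) sn (u * m)%R) * (\rsum_(n : F) sn (v * n)%R)).
  rewrite -!rsum_mulr -rsum_sub; apply: eq_bigr => m _.
  rewrite -!rsum_mull -rsum_sub; apply: eq_bigr => n _.
  by rewrite csD // ![(_ * m)%R]mulrC ![(_ * n)%R]mulrC.
by rewrite !sn_orth // !cs_orth //; ring.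
Qed.

Definition quartic (x y z : F) : F := (x * y * z * (x ^+ 2 + y ^+ 2 + z ^+ 2))%R.

Lemma moment_count : (2%:R != 0 :> F)%R -> (5%:R != 0 :> F)%R ->
  \rsum_(m : F) \rsum_(n : F) A m n ^ 4 =
  INR p ^ 2 * \rsum_(x : F) \rsum_(y : F) \rsum_(z : F) ind (quartic x y z == 0%R).
Proof.
move=> two5 five0.
under eq_bigr => m _ do under eq_bigr => n _ do rewrite A_pow4.
transitivity (INR p ^ 2 * \rsum_(a : F) \rsum_(b : F) \rsum_(c : F) \rsum_(d : F)
    (ind (a ^+ 5 + b ^+ 5 + c ^+ 5 + d ^+ 5 == 0)%R * ind (a + b + c + d == 0)%R)).
  under eq_bigr => m _ do rewrite exchange_big /=.
  rewrite exchange_big /= -rsum_mull; apply: eq_bigr => a _.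
  under eq_bigr => m _ do rewrite exchange_big /=.
  rewrite exchange_big /= -rsum_mull; apply: eq_bigr => b _.
  under eq_bigr => m _ do rewrite exchange_big /=.
  rewrite exchange_big /= -rsum_mull; apply: eq_bigr => c _.
  under eq_bigr => m _ do rewrite exchange_big /=.
  rewrite exchange_big /= -rsum_mull; apply: eq_bigr => d _.
  exact: cs_orth2.
congr (_ * _).
transitivity (\rsum_(a : F) \rsum_(b : F) \rsum_(c : F)
    ind (quartic (a + b)%R (b + c)%R (c + a)%R == 0%R)).
  apply: eq_bigr => a _; apply: eq_bigr => b _; apply: eq_bigr => c _.
  under eq_bigr => d _ do
    rewrite Rmult_comm [(_ + d)%R]addrC addr_eq0.
  rewrite rsum_delta FpIdentities.sum_fifth_powers oppr_eq0 mulf_eq0 (negbTE five0) /=.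
  by rewrite /quartic -FpIdentities.sum_squares_pairs !mulf_eq0 (negbTE two5).
(* The map (a, b, c) -> (a + b, b + c, c + a) is inverted one variable at a time; the last
   substitution solves 2 c = z - x + y, which uses that 2 is invertible. *)
rewrite exchange_big /=.
under eq_bigr => b _ do rewrite (reindex_inj (addIr (- b)%R)) /=.
rewrite exchange_big /=; apply: eq_bigr => x _.
under eq_bigr => b _ do under eq_bigr => c _ do rewrite subrK.
rewrite exchange_big /=.
under eq_bigr => c _ do rewrite (reindex_inj (addIr (- c)%R)) /=.
rewrite exchange_big /=; apply: eq_bigr => y _.
under eq_bigr => c _ do rewrite subrK.
have inj : injective (fun z : F => (z - x + y) / 2%:R)%R.
  by move=> z z' /(mulIf (invr_neq0 two5)) /addIr /addIr.
rewrite (reindex_inj inj) /=; apply: eq_bigr => z _.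
by rewrite addrA FpIdentities.shift_pairs.
Qed.

Lemma A_rescale m n s : s != 0%R -> A m n = A (m * s ^+ 5)%R (n * s)%R.
Proof.
move=> s0; rewrite /A (reindex_inj (mulIf s0)) /=.
by apply: eq_bigr => a _; rewrite FpIdentities.phase_rescale.
Qed.

Definition Fval (r : F) : R := \rsum_(n : F | n != 0%R) A (r * n)%R n ^ 4.

Lemma Fval_fourth_power r t : t != 0%R -> Fval (r * t ^+ 4)%R = Fval r.
Proof.
move=> t0; rewrite [RHS](reindex_inj (mulIf (invr_neq0 t0))) /=.
apply: eq_big => [n|n _]; first by rewrite mulf_eq0 invr_eq0 (negbTE t0) orbF.
rewrite (A_rescale _ _ (invr_neq0 t0)) (@FpIdentities.phase_orbit _ _ t) //.
exact: mulfV.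
Qed.

End Moment.

(** * Squares modulo a prime congruent to 3 modulo 4 *)

Section ThreeModFour.
Variable p : nat.
Hypothesis p_pr : prime p.
Hypothesis p_mod4 : (p %% 4 = 3)%N.
Hypothesis p_gt3 : (3 < p)%N.
Local Notation F := 'F_p.

Lemma natr_neq0 k : (0 < k < p)%N -> (k%:R != 0 :> F)%R.
Proof.
case/andP=> k0 kp; rewrite -[0%R]/(0%:R : F)%R eq_natr_Fp // mod0n modn_small //.
by rewrite -lt0n.
Qed.

Lemma two_neq0 : (2%:R != 0 :> F)%R.
Proof. by apply: natr_neq0; rewrite /= ltnW. Qed.

Lemma five_neq0 : (5%:R != 0 :> F)%R.
Proof.
apply: natr_neq0; rewrite /=; move: p_mod4 p_gt3.
by case: p => [|[|[|[|[|[|n]]]]]].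
Qed.

(** Write p = 4 j + 3. For x <> 0, x^(2j+1) is 1 or -1, so (x^(j+1))^2 = x x^(2j+1) is x or -x. *)
Lemma pm_square (x : F) : exists y : F, x = (y ^+ 2)%R \/ x = (- (y ^+ 2))%R.
Proof.
have [->|x0] := eqVneq x 0%R; first by exists 0%R; left; rewrite expr0n.
pose j := (p %/ 4)%N.
have pj : p = (4 * j + 3)%N by rewrite {1}(divn_eq p 4) p_mod4 mulnC.
have : (x ^+ (2 * j + 1) == 1)%R || (x ^+ (2 * j + 1) == -1)%R.
  rewrite -sqrf_eq1 -exprM; have := finfield.expf_card x; rewrite card_Fp // => h.
  apply/eqP; apply: (mulfI x0); rewrite mulr1 -exprS -[RHS]h; congr (x ^+ _)%R.
  by rewrite {}pj; lia.
case/orP=> /eqP h; exists (x ^+ j.+1)%R; [left | right];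
  by rewrite -exprM (_ : (j.+1 * 2 = (2 * j + 1).+1)%N) ?exprS ?h ?mulr1 ?mulrN1 ?opprK //; lia.
Qed.

(** In x = +- y^2 write y = +- z^2: squaring removes the inner sign. *)
Lemma pm_fourth_power (x : F) : exists t : F, x = (t ^+ 4)%R \/ x = (- (t ^+ 4))%R.
Proof.
have [y hy] := pm_square x; have [z hz] := pm_square y; exists z.
have -> : (z ^+ 4 = y ^+ 2)%R by case: hz => ->; rewrite ?sqrrN -exprM.
exact: hy.
Qed.

Lemma neq_opp (x : F) : x != 0%R -> x != (- x)%R.
Proof.
by move=> x0; rewrite -addr_eq0 -mulr2n -mulr_natl mulf_eq0 negb_or x0 two_neq0.
Qed.

(** Each y is hit at least twice: by w and -w for a signed root w, or by both signs at x = 0 when y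
    = 0. The total count over all y is 2 p, so every count equals 2. *)
Lemma signed_squares (y : F) :
  \rsum_(x : F) (ind (x ^+ 2 == y)%R + ind (- (x ^+ 2) == y)%R) = 2.
Proof.
pose n (y : F) := \rsum_(x : F) (ind (x ^+ 2 == y)%R + ind (- (x ^+ 2) == y)%R).
have ge0 (b c : bool) : 0 <= ind b + ind c by have := ind_ge0 b; have := ind_ge0 c; lra.
have n_ge2 z : 2 <= n z.
  have [->|z0] := eqVneq z 0%R.
    rewrite /n (bigD1 0%R) //= expr0n oppr0 eqxx /=.
    rewrite -[X in X <= _]Rplus_0_r; apply: Rplus_le_compat; first by lra.
    by apply: rsum_ge0 => x _; apply: ge0.
  have [w hw] := pm_square z.
  have w0 : w != 0%R.
    by apply: contraNneq z0 => w0; case: hw => ->; rewrite w0 expr0n ?oppr0.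
  rewrite /n (bigD1 w) //= (bigD1 (- w)%R) /=; last by rewrite eq_sym neq_opp.
  rewrite sqrrN.
  have : 1 <= ind (w ^+ 2 == z)%R + ind (- (w ^+ 2) == z)%R.
    have aux b : 1 <= ind true + ind b /\ 1 <= ind b + ind true.
      by have := ind_ge0 b; rewrite /=; lra.
    by case: hw => ->; rewrite eqxx; apply aux.
  move=> h; rewrite -[X in X <= _]Rplus_0_r -Rplus_assoc.
  apply: Rplus_le_compat; first by rewrite (_ : 2 = 1 + 1) //; apply: Rplus_le_compat.
  by apply: rsum_ge0 => x _; apply: ge0.
have tot : \rsum_(z : F) (n z - 2) = 0.
  rewrite rsum_sub rsum_const /n exchange_big /=.
  under eq_bigr => x _ do rewrite rsum_add.
  have one (u : F) : \rsum_(z : F) ind (u == z) = 1.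
    by rewrite -[RHS](rsum_delta' u (fun=> 1)); apply: eq_bigr => i _; rewrite Rmult_1_r.
  by under eq_bigr => x _ do rewrite !one; rewrite rsum_const Rminus_diag_eq //; ring.
apply: Rle_antisym; last exact: n_ge2.
move: tot; rewrite (bigD1 y) //=; set S := (X in _ + X) => tot.
have : 0 <= S by apply: rsum_ge0 => z _; have := n_ge2 z; lra.
by rewrite -/(n y); lra.
Qed.

Lemma rsum_squares (f : F -> R) :
  \rsum_(x : F) f (x ^+ 2)%R + \rsum_(x : F) f (- (x ^+ 2))%R = 2 * \rsum_(y : F) f y.
Proof.
rewrite -rsum_add -rsum_mull.
transitivity (\rsum_(x : F) \rsum_(y : F)
    ((ind (x ^+ 2 == y)%R + ind (- (x ^+ 2) == y)%R) * f y)).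
  apply: eq_bigr => x _; under eq_bigr => y _ do rewrite Rmult_plus_distr_r.
  by rewrite rsum_add !rsum_delta'.
rewrite exchange_big /=; apply: eq_bigr => y _.
by rewrite rsum_mulr signed_squares.
Qed.

(** The cosine is even, so x^2 and -x^2 contribute equally and [rsum_squares] reduces the sum to
    [cs_orth]: the quadratic Gauss sum is purely imaginary. *)
Lemma rsum_cs_square (t : F) : t != 0%R -> \rsum_(x : F) cs (t * x ^+ 2)%R = 0.
Proof.
move=> t0; have := rsum_squares (fun x => cs (t * x)%R).
under [X in _ + X]eq_bigr => x _ do rewrite mulrN csN //.
rewrite cs_orth // (negbTE t0) /= => h.
have dbl (a b : R) : a + a = 2 * b -> a = b by lra.
by rewrite (dbl _ _ h) Rmult_0_r.
Qed.

(** Detect the equation by a sum over t. For t <> 0 the Gauss sum is i K with K real, its cube is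
    again purely imaginary, and the cosine sum vanishes. The term t = 0 gives p^3. *)
Lemma quadric_count :
  \rsum_(x : F) \rsum_(y : F) \rsum_(z : F) ind (x ^+ 2 + y ^+ 2 + z ^+ 2 == 0)%R
  = INR p ^ 2.
Proof.
have p0 := INR_p_gt0 p_pr.
apply: (Rmult_eq_reg_l (INR p)); last by lra.
transitivity (\rsum_(t : F) \rsum_(x : F) \rsum_(y : F) \rsum_(z : F)
    cs (t * z ^+ 2 + (t * y ^+ 2 + t * x ^+ 2))%R).
  rewrite -rsum_mull exchange_big /=; apply: eq_bigr => x _.
  rewrite -rsum_mull exchange_big /=; apply: eq_bigr => y _.
  rewrite -rsum_mull exchange_big /=; apply: eq_bigr => z _.
  rewrite -cs_orth //; apply: eq_bigr => t _; congr cs.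
  by rewrite mulrC !mulrDr addrC [(t * x ^+ 2 + _)%R]addrC.
rewrite (bigD1 0%R) //= [X in _ + X]rsum0; last first.
  move=> t t0; pose K := \rsum_(z : F) sn (t * z ^+ 2)%R.
  have hc th : \rsum_(z : F) cs (t * z ^+ 2 + th)%R = - K * sn th.
    transitivity ((\rsum_(z : F) cs (t * z ^+ 2)%R) * cs th - K * sn th); last first.
      by rewrite rsum_cs_square //; ring.
    by rewrite -!rsum_mulr -rsum_sub; apply: eq_bigr => z _; rewrite csD.
  have hs th : \rsum_(z : F) sn (t * z ^+ 2 + th)%R = K * cs th.
    transitivity (K * cs th + (\rsum_(z : F) cs (t * z ^+ 2)%R) * sn th); last first.
      by rewrite rsum_cs_square //; ring.
    by rewrite -!rsum_mulr -rsum_add; apply: eq_bigr => z _; rewrite snD.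
  under eq_bigr => x _ do under eq_bigr => y _ do rewrite hc.
  under eq_bigr => x _ do rewrite rsum_mull hs.
  by rewrite rsum_mull rsum_mull rsum_cs_square //; ring.
under eq_bigr => x _ do under eq_bigr => y _ do under eq_bigr => z _ do
  rewrite !mul0r !addr0 cs0 //.
by do 3![under eq_bigr => x _ do rewrite ?rsum_const]; rewrite !rsum_const card_Fp //; ring.
Qed.

Lemma square_roots_le2 (y : F) : \rsum_(x : F) ind (x ^+ 2 == y)%R <= 2.
Proof.
rewrite -(signed_squares y); apply: rsum_le => x _.
by rewrite -[X in X <= _]Rplus_0_r; apply: Rplus_le_compat_l; apply: ind_ge0.
Qed.

Lemma rsum_ind_eq0 : \rsum_(x : F) ind (x == 0%R) = 1.
Proof. by rewrite -[RHS](rsum_delta (0%R : F) (fun=> 1)); apply: eq_bigr => i _; rewrite Rmult_1_r. Qed.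

(** Bonferroni inequalities for three planes and the quadric, each with p^2 points. Two planes meet
    in p points, and a plane meets the quadric in at most 2 p, since a value has at most two square
    roots: 3 p + 6 p = 9 p. *)
Lemma quartic_count :
  4 * INR p ^ 2 - 9 * INR p <=
  \rsum_(x : F) \rsum_(y : F) \rsum_(z : F) ind (quartic x y z == 0%R) <=
  4 * INR p ^ 2.
Proof.
pose Q (x y z : F) := ind (x ^+ 2 + y ^+ 2 + z ^+ 2 == 0)%R.
pose e (x : F) := ind (x == 0%R).
have p0 := INR_p_gt0 p_pr.
have qE x y z : ind (quartic x y z == 0%R) =
    1 - (1 - e x) * (1 - e y) * (1 - e z) * (1 - Q x y z).
  rewrite /quartic !mulf_eq0 /e /Q.
  by case: (x == 0%R); case: (y == 0%R); case: (z == 0%R); case: (x ^+ 2 + y ^+ 2 + z ^+ 2 == 0)%R => /=; ring.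
have e1 : \rsum_x e x = 1 := rsum_ind_eq0.
have cst c : \rsum_(x : F) c = INR p * c by rewrite rsum_const card_Fp.
have sum1 : \rsum_(x : F) \rsum_(y : F) \rsum_(z : F) (e x + e y + e z + Q x y z) = 4 * INR p ^ 2.
  do 3![under eq_bigr => x _ do under eq_bigr => y _ do rewrite ?rsum_add ?cst ?e1].
  do 3![under eq_bigr => x _ do rewrite ?rsum_add ?cst ?rsum_mull ?e1].
  by rewrite !rsum_add !rsum_mull !cst quadric_count e1; ring.
have Qx y : \rsum_z Q y z 0%R <= 2.
  apply: Rle_trans (square_roots_le2 (- y ^+ 2)%R); apply: rsum_le => z _.
  by rewrite /Q expr0n addr0 addrC addr_eq0; apply: Rle_refl.
split; last first.
  rewrite -sum1; apply: rsum_le => x _; apply: rsum_le => y _; apply: rsum_le => z _.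
  rewrite qE.
  have := ind_ge0 (x == 0%R); have := ind_ge0 (y == 0%R); have := ind_ge0 (z == 0%R).
  rewrite /e /Q; case: (x == 0%R); case: (y == 0%R); case: (z == 0%R); case: (x ^+ 2 + y ^+ 2 + z ^+ 2 == 0)%R => /=; lra.
pose cross x y z := e x * e y + e y * e z + e x * e z + e x * Q y z 0%R + e y * Q x z 0%R + e z * Q x y 0%R.
have ptw x y z : e x + e y + e z + Q x y z - cross x y z <= ind (quartic x y z == 0%R).
  have qx : e x * Q x y z = e x * Q y z 0%R.
    by rewrite /e; case: eqP => [->|_] /=; rewrite /Q ?expr0n ?add0r ?addr0 //; ring.
  have qy : e y * Q x y z = e y * Q x z 0%R.
    by rewrite /e; case: eqP => [->|_] /=; rewrite /Q ?expr0n ?add0r ?addr0 //; ring.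
  have qz : e z * Q x y z = e z * Q x y 0%R.
    by rewrite /e; case: eqP => [->|_] /=; rewrite /Q ?expr0n ?add0r ?addr0 //; ring.
  rewrite /cross -qx -qy -qz qE /e /Q.
  by case: (x == 0%R); case: (y == 0%R); case: (z == 0%R); case: (x ^+ 2 + y ^+ 2 + z ^+ 2 == 0)%R => /=; lra.
pose S3 (f : F -> F -> F -> R) := \rsum_(x : F) \rsum_(y : F) \rsum_(z : F) f x y z.
have S3D f g : S3 (fun x y z => f x y z + g x y z) = S3 f + S3 g.
  rewrite /S3 -rsum_add; apply: eq_bigr => x _.
  by rewrite -rsum_add; apply: eq_bigr => y _; rewrite -rsum_add.
have S3B f g : S3 (fun x y z => f x y z - g x y z) = S3 f - S3 g.
  rewrite /S3 -rsum_sub; apply: eq_bigr => x _.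
  by rewrite -rsum_sub; apply: eq_bigr => y _; rewrite -rsum_sub.
have e_ge0 x : 0 <= e x by apply: ind_ge0.
have c1 : S3 (fun x y z => e x * e y) = INR p.
  rewrite /S3; under eq_bigr => x _ do under eq_bigr => y _ do rewrite cst.
  under eq_bigr => x _ do rewrite rsum_mull rsum_mull e1.
  by rewrite rsum_mull rsum_mulr e1; ring.
have c2 : S3 (fun x y z => e y * e z) = INR p.
  rewrite /S3; under eq_bigr => x _ do under eq_bigr => y _ do rewrite rsum_mull e1.
  under eq_bigr => x _ do rewrite rsum_mulr e1.
  by rewrite cst; ring.
have c3 : S3 (fun x y z => e x * e z) = INR p.
  rewrite /S3; under eq_bigr => x _ do under eq_bigr => y _ do rewrite rsum_mull e1.
  under eq_bigr => x _ do rewrite cst.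
  by rewrite rsum_mull rsum_mulr e1; ring.
have c4 : S3 (fun x y z => e x * Q y z 0%R) <= 2 * INR p.
  apply: (@Rle_trans _ (S3 (fun x y z => e x * Q y z 0%R))); first exact: Rle_refl.
  apply: (@Rle_trans _ (\rsum_(x : F) \rsum_(y : F) (e x * 2))).
    apply: rsum_le => x _; apply: rsum_le => y _; rewrite rsum_mull.
    by apply: Rmult_le_compat_l.
  under eq_bigr => x _ do rewrite cst.
  by rewrite rsum_mull rsum_mulr e1; lra.
have c5 : S3 (fun x y z => e y * Q x z 0%R) <= 2 * INR p.
  apply: (@Rle_trans _ (\rsum_(x : F) \rsum_(y : F) (e y * 2))).
    apply: rsum_le => x _; apply: rsum_le => y _; rewrite rsum_mull.
    by apply: Rmult_le_compat_l.
  under eq_bigr => x _ do rewrite rsum_mulr e1.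
  by rewrite cst; lra.
have c6 : S3 (fun x y z => e z * Q x y 0%R) <= 2 * INR p.
  apply: (@Rle_trans _ (\rsum_(x : F) 2)); last by rewrite cst; lra.
  apply: rsum_le => x _.
  under eq_bigr => y _ do rewrite rsum_mulr e1 Rmult_1_l.
  exact: Qx.
have cr : S3 cross <= 9 * INR p by rewrite /cross !S3D; lra.
apply: (@Rle_trans _ (S3 (fun x y z => e x + e y + e z + Q x y z - cross x y z))).
  by rewrite S3B {1}/S3 sum1; lra.
by apply: rsum_le => x _; apply: rsum_le => y _; apply: rsum_le => z _; apply: ptw.
Qed.

End ThreeModFour.

(** * The fourth moment and its twists *)

Section FourthMoment.
Variable p : nat.
Hypothesis p_pr : prime p.
Hypothesis p_mod4 : (p %% 4 = 3)%N.
Hypothesis p_gt3 : (3 < p)%N.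
Local Notation F := 'F_p.

Lemma fifth_roots_le5 (y : F) : \rsum_(x : F) ind (x ^+ 5 == y)%R <= 5.
Proof.
have -> : \rsum_(x : F) ind (x ^+ 5 == y)%R = INR #|[pred x : F | (x ^+ 5 == y)%R]|.
  rewrite -[RHS]Rmult_1_r -rsum_const rsum_ind.
  by apply: eq_bigr => x _; rewrite Rmult_1_r.
rewrite (_ : 5%Re = INR 5); last (by rewrite /=; lra); apply: le_INR; apply/leP.
pose q : {poly F} := ('X^5 - y%:P)%R.
have sq : size q = 6%N by apply: size_XnsubC.
have q0 : q != 0%R by rewrite -size_poly_eq0 sq.
rewrite (cardE [pred x : F | (x ^+ 5 == y)%R]) -ltnS -sq; apply: (max_poly_roots q0); last exact: enum_uniq.
apply/allP => x; rewrite mem_enum inE => /eqP h.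
by rewrite rootE /q !hornerE h subrr.
Qed.

Lemma A_n0_fifth_power (m t : F) : t != 0%R -> A (m * t ^+ 5)%R 0%R = A m 0%R.
Proof. by move=> t0; rewrite [RHS](A_rescale _ _ t0) mul0r. Qed.

(** By orthogonality the left side is p times the number of solutions of a^5 = - b^5, and each b
    allows at most five a. *)
Lemma A_n0_second_moment : \rsum_(m : F) A m 0%R ^ 2 <= 5 * INR p ^ 2.
Proof.
have p0 := INR_p_gt0 p_pr.
have -> : \rsum_(m : F) A m 0%R ^ 2 =
    INR p * \rsum_(b : F) \rsum_(a : F) ind (a ^+ 5 == - (b ^+ 5))%R.
  pose g (m a : F) := (m * a ^+ 5 + 0 * a)%R.
  have gN m a : g m (- a)%R = (- g m a)%R by apply: phase_odd.
  transitivity (\rsum_(m : F) \rsum_(b : F) \rsum_(a : F) cs ((a ^+ 5 + b ^+ 5) * m)%R).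
    apply: eq_bigr => m _; rewrite /= Rmult_1_r {1}/A -rsum_mulr.
    apply: eq_bigr => b _; rewrite Rmult_comm (rsum_cs_shift p_pr _ (gN m)) //.
    by apply: eq_bigr => a _; rewrite /g !mul0r !addr0 -mulrDr mulrC.
  rewrite exchange_big -rsum_mull; apply: eq_bigr => b _.
  rewrite exchange_big -rsum_mull; apply: eq_bigr => a _.
  by rewrite cs_orth // addr_eq0.
have : \rsum_(b : F) \rsum_(a : F) ind (a ^+ 5 == - (b ^+ 5))%R <= \rsum_(b : F) 5.
  by apply: rsum_le => b _; apply: fifth_roots_le5.
rewrite rsum_const card_Fp // => h.
apply: Rle_trans (Rmult_le_compat_l (INR p) _ _ (Rlt_le _ _ p0) h) _.
by apply: Req_le; ring.
Qed.

Lemma INR_p_ge7 : 7 <= INR p.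
Proof.
rewrite (_ : 7%Re = INR 7); last (by rewrite /=; lra); apply: le_INR; apply/leP; move: p_mod4 p_gt3.
by case: p => [|[|[|[|[|[|[|n]]]]]]].
Qed.

Lemma card_nonzero : INR #|[pred x : F | x != 0%R]| = INR p - 1.
Proof.
have := cardC1 (0%R : F); rewrite card_Fp // => h.
rewrite (eq_card (B := predC1 (0%R : F))) ?h //.
by rewrite -subn1 minus_INR //; apply/leP; apply: prime_gt0.
Qed.

(** The value A(m, 0) is constant along m t^5, t <> 0, and t -> m t^5 is at most five to one. So p -
    1 copies of A(m, 0)^2 fit into five times the second moment, whence A(m, 0)^2 <= 25 p^2 / (p -
    1) <= 50 p. *)
Lemma A_n0_bound (m : F) : m != 0%R -> A m 0%R ^ 4 <= 2500 * INR p ^ 2.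
Proof.
move=> m0; have p7 := INR_p_ge7.
set B := A m 0%R.
suff h : (INR p - 1) * B ^ 2 <= 25 * INR p ^ 2.
  have b2 : 0 <= B ^ 2 by apply: pow2_ge_0.
  have : B ^ 2 <= 50 * INR p by nra.
  move=> h2; have -> : B ^ 4 = B ^ 2 * B ^ 2 by ring.
  have := Rmult_le_compat _ _ _ _ b2 b2 h2 h2.
  by have -> : 50 * INR p * (50 * INR p) = 2500 * INR p ^ 2 by ring.
rewrite -card_nonzero -rsum_const.
apply: (@Rle_trans _ (\rsum_(t : F) A (m * t ^+ 5)%R 0%R ^ 2)).
  rewrite [X in X <= _]big_mkcond; apply: rsum_le => t _.
  case: ifP => /= t0; last by apply: (pow2_ge_0 (A (m * t ^+ 5)%R 0%R)).
  by rewrite A_n0_fifth_power //; apply: Rle_refl.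
apply: (@Rle_trans _ (\rsum_(x : F) (5 * A x 0%R ^ 2))); last first.
  rewrite rsum_mull (_ : 25 * INR p ^ 2 = 5 * (5 * INR p ^ 2)); last by ring.
  by apply: Rmult_le_compat_l A_n0_second_moment; lra.
have -> : \rsum_(t : F) A (m * t ^+ 5)%R 0%R ^ 2 =
    \rsum_(x : F) ((\rsum_(t : F) ind (t ^+ 5 == x / m)%R) * A x 0%R ^ 2).
  under [RHS]eq_bigr => x _ do rewrite -rsum_mulr.
  rewrite exchange_big; apply: eq_bigr => t _.
  rewrite -(rsum_delta (m * t ^+ 5)%R (fun x => A x 0%R ^ 2)); apply: eq_bigr => x _.
  congr (ind _ * _); apply/eqP/eqP => [->|->].
    by rewrite mulrAC mulfV // mul1r.
  by rewrite mulrCA mulfV // mulr1.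
apply: rsum_le => x _; apply: Rmult_le_compat_r; first exact: pow2_ge_0.
exact: fifth_roots_le5.
Qed.

(** From the full moment p^2 M remove A(0, 0)^4 = p^4, the vanishing terms A(0, n), and the sum E
    over n = 0, m <> 0. The errors are 9 p^3 from the point count and 2500 p^3 from E; 2600 is a
    round bound. *)
Lemma fourth_moment :
  Rabs (\rsum_(m : F | m != 0%R) \rsum_(n : F | n != 0%R) A m n ^ 4 - 3 * INR p ^ 4)
  <= 2600 * INR p ^ 3.
Proof.
have p7 := INR_p_ge7.
have := quartic_count p_pr p_mod4 p_gt3.
have := moment_count p_pr (two_neq0 p_pr p_gt3) (five_neq0 p_pr p_mod4 p_gt3).
set M := \rsum_(x : F) \rsum_(y : F) \rsum_(z : F) _ => tot cnt.
set T := \rsum_(m : F | m != 0%R) _.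
have A00 : A (0%R : F) 0%R = INR p.
  rewrite /A; under eq_bigr => a _ do rewrite !mul0r addr0 cs0 //.
  by rewrite rsum_const card_Fp // Rmult_1_r.
have A0n (n : F) : n != 0%R -> A 0%R n = 0.
  move=> n0; rewrite /A; under eq_bigr => a _ do rewrite mul0r add0r.
  by rewrite cs_orth // (negbTE n0) /= Rmult_0_r.
pose E := \rsum_(m : F | m != 0%R) A m 0%R ^ 4.
have split_tot : INR p ^ 2 * M = INR p ^ 4 + E + T.
  rewrite -tot (bigD1 0%R) //= (bigD1 0%R) //= A00.
  rewrite [X in _ + X + _]rsum0; last by move=> n n0; rewrite A0n //; ring.
  rewrite (_ : \rsum_(i | i != 0%R) _ = E + T) ?Rplus_0_r -?Rplus_assoc //.
  by rewrite -rsum_add; apply: eq_bigr => m m0; rewrite (bigD1 0%R).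
have E0 : 0 <= E by apply: rsum_ge0 => m _; have -> : A m 0%R ^ 4 = (A m 0%R ^ 2) ^ 2 by [ring]; apply: pow2_ge_0.
have E1 : E <= 2500 * INR p ^ 3.
  apply: (@Rle_trans _ (\rsum_(m : F | m != 0%R) (2500 * INR p ^ 2))).
    by apply: rsum_le => m m0; apply: A_n0_bound.
  by rewrite rsum_const card_nonzero; nra.
have c1 := Rmult_le_compat_l (INR p ^ 2) _ _ (pow2_ge_0 _) (proj1 cnt).
have c2 := Rmult_le_compat_l (INR p ^ 2) _ _ (pow2_ge_0 _) (proj2 cnt).
move: split_tot E0 E1 c1 c2; rewrite -/M; move: (INR p ^ 2 * M) E T => X E T h1 h2 h3 h4 h5.
have p3 : 0 < INR p ^ 3 by apply: pow_lt; lra.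
have e1 : INR p ^ 2 * (4 * INR p ^ 2 - 9 * INR p) = 4 * INR p ^ 4 - 9 * INR p ^ 3 by ring.
have e2 : INR p ^ 2 * (4 * INR p ^ 2) = 4 * INR p ^ 4 by ring.
by apply: Rabs_le; lra.
Qed.

Lemma Fval_total : \rsum_(r : F | r != 0%R) Fval r =
  \rsum_(m : F | m != 0%R) \rsum_(n : F | n != 0%R) A m n ^ 4.
Proof.
rewrite /Fval exchange_big [RHS]exchange_big /=; apply: eq_bigr => n n0.
rewrite [RHS](reindex_inj (mulIf n0)) /=; apply: eq_big => [r|//].
by rewrite mulf_eq0 (negbTE n0) orbF.
Qed.

(** The quotient r / s is a fourth power up to sign, and a minus sign only exchanges the two
    summands. *)
Lemma Fval_pm (r s : F) : r != 0%R -> s != 0%R ->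
  Fval r + Fval (- r)%R = Fval s + Fval (- s)%R.
Proof.
move=> r0 s0; have [t ht] := pm_fourth_power p_pr p_mod4 p_gt3 (r / s)%R.
have rs : r = (s * (r / s))%R by rewrite mulrCA mulfV // mulr1.
have t0 : t != 0%R.
  apply: contraNneq r0 => t0; rewrite rs; apply/eqP.
  by case: ht => ->; rewrite t0 expr0n ?oppr0 mulr0.
case: ht => ht; rewrite rs ht.
  by rewrite -mulNr !Fval_fourth_power.
by rewrite mulrN opprK -mulNr !Fval_fourth_power // Rplus_comm.
Qed.

(* Fval r + Fval (- r) is constant for r != 0, so an even weight decouples from Fval. *)
Lemma even_weight_decouples (W : F -> R) : (forall r, W (- r)%R = W r) ->
  (INR p - 1) * \rsum_(r : F | r != 0%R) (W r * Fval r) =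
  (\rsum_(r : F | r != 0%R) W r) * \rsum_(r : F | r != 0%R) Fval r.
Proof.
move=> W_even; set H := Fval (1%R : F) + Fval (- 1 : F)%R.
have sym (f : F -> R) : 2 * \rsum_(r : F | r != 0%R) f r =
    \rsum_(r : F | r != 0%R) (f r + f (- r)%R).
  have dbl (a b : R) : b = a -> 2 * a = a + b by lra.
  rewrite rsum_add; apply: dbl; rewrite [RHS](reindex_inj oppr_inj) /=.
  by apply: eq_bigl => r; rewrite oppr_eq0.
have hF : 2 * \rsum_(r : F | r != 0%R) Fval r = (INR p - 1) * H.
  rewrite sym -card_nonzero -rsum_const; apply: eq_bigr => r r0.
  by rewrite (Fval_pm r0 (oner_neq0 _)).
have hW : 2 * \rsum_(r : F | r != 0%R) (W r * Fval r) = (\rsum_(r : F | r != 0%R) W r) * H.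
  rewrite sym -rsum_mulr; apply: eq_bigr => r r0.
  by rewrite W_even -Rmult_plus_distr_l (Fval_pm r0 (oner_neq0 _)).
apply: (Rmult_eq_reg_l 2); last by lra.
transitivity ((INR p - 1) * (2 * \rsum_(r : F | r != 0%R) (W r * Fval r))); first by ring.
rewrite hW; transitivity ((\rsum_(r : F | r != 0%R) W r) * (2 * \rsum_(r : F | r != 0%R) Fval r)).
  by rewrite hF; ring.
by ring.
Qed.

End FourthMoment.

(** * Dedekind sums as cotangent sums *)

Lemma sin_ge_x_cos (x : R) : 0 <= x <= PI / 2 -> x * cos x <= sin x.
Proof.
case=> x0 x1; have [<-|xp] := Req_dec 0 x; first by rewrite Rmult_0_l sin_0; lra.
pose f y := sin y - y * cos y; pose f' y := y * sin y.
have df c : 0 <= c <= x -> derivable_pt_lim f c (f' c).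
  by move=> _; apply/is_derive_Reals; rewrite /f /f'; auto_derive => //; ring.
have [c [hc c01]] : exists c, f x - f 0 = f' c * (x - 0) /\ 0 < c < x.
  by apply: MVT_cor2 => //; lra.
have s0 : 0 <= sin c by apply: sin_ge_0; lra.
have : 0 <= f' c * (x - 0) by apply: Rmult_le_pos; last lra; apply: Rmult_le_pos => //; lra.
by rewrite -hc /f sin_0; lra.
Qed.

Lemma one_sub_cos_le (x : R) : 1 - cos x <= x ^ 2 / 2.
Proof.
have -> : cos x = 1 - 2 * sin (x / 2) * sin (x / 2) by rewrite -cos_2a_sin; congr cos; lra.
have : (sin (x / 2)) ^ 2 <= (x / 2) ^ 2.
  rewrite -!Rsqr_pow2; apply: Rsqr_le_abs_1.
  have h y : 0 <= y -> Rabs (sin y) <= y.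
    move=> y0; have [y1|y1] := Rle_dec y 1; last first.
      by have := SIN_bound y => b; apply: Rabs_le; lra.
    rewrite Rabs_pos_eq; last by apply: sin_ge_0 => //; have := PI2_1; lra.
    by have [<-|?] := Req_dec 0 y; [rewrite sin_0; lra | apply: Rlt_le; apply: sin_lt_x; lra].
  have [x0|x0] := Rle_dec 0 (x / 2); first by rewrite (Rabs_pos_eq (x / 2)) //; apply: h.
  rewrite -(Rabs_Ropp (sin _)) -sin_neg -(Rabs_Ropp (x / 2)) (Rabs_pos_eq (- _)); last by lra.
  by apply: h; lra.
by move=> h; have -> : x ^ 2 / 2 = 2 * (x / 2) ^ 2 by [field]; lra.
Qed.

(** Quantifies cot x ~ 1 / x. The second bound combines cos x >= 1 - x^2 / 2 with sin x <= x. *)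
Lemma x_cot_bounds (x : R) : 0 < x <= PI / 2 ->
  0 <= x * (cos x / sin x) <= 1 /\ 1 - x * (cos x / sin x) <= x ^ 2 / 2.
Proof.
move=> x01; have s0 : 0 < sin x by apply: sin_gt_0; lra.
have c0 : 0 <= cos x by apply: cos_ge_0; lra.
have sx : sin x <= x by apply: Rlt_le; apply: sin_lt_x; lra.
have h1 := @sin_ge_x_cos x; have h2 := one_sub_cos_le x.
have e : x * (cos x / sin x) * sin x = x * cos x by field; lra.
move: (x * (cos x / sin x)) e => t e.
have t0 : 0 <= t.
  apply: (Rmult_le_reg_r (sin x)) => //; rewrite Rmult_0_l e.
  by apply: Rmult_le_pos => //; lra.
have t1 : t <= 1.
  by apply: (Rmult_le_reg_r (sin x)) => //; rewrite Rmult_1_l e; apply: h1; lra.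
split=> //.
(* If x^2 / 2 exceeds 1 the bound follows from x cot x >= 0; otherwise 1 - x^2 / 2 is nonnegative
   and sin x <= x may be multiplied by it. *)
have [x2|x2] := Rle_dec (x ^ 2 / 2) 1; last by lra.
apply: (Rmult_le_reg_r (sin x)) => //.
have : (1 - x ^ 2 / 2) * sin x <= (1 - x ^ 2 / 2) * x by apply: Rmult_le_compat_l; lra.
have : x * (1 - x ^ 2 / 2) <= x * cos x by apply: Rmult_le_compat_l; lra.
by move=> h3 h4; rewrite Rmult_minus_distr_r e; lra.
Qed.

Section Dedekind.
Variable p : nat.
Hypothesis p_pr : prime p.
Hypothesis p_gt3 : (3 < p)%N.
Local Notation F := 'F_p.

(* The half-angle form of cot (pi x / p); at x = 0 it gives 0 / 0 = 0. *)
Definition ct (x : F) : R := sn x / (1 - cs x).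
Definition sawF (x : F) : R := if x == 0%R then 0 else INR x / INR p - 1 / 2.
Definition dedF (h : F) : R := \rsum_(a : F) (sawF a * sawF (a * h)%R).

Lemma ctN x : ct (- x)%R = - ct x.
Proof. by rewrite /ct snN // csN // /Rdiv Ropp_mult_distr_l. Qed.

Lemma ct0 : ct 0%R = 0.
Proof. by rewrite /ct sn0 // /Rdiv Rmult_0_l. Qed.

(** The right side of Eisenstein's formula ((a / p)) = - 1 / (2 p) times the sum over k of sin(2 pi
    k a / p) cot(pi k / p). *)
Definition cot_sine_sum (a : F) : R := \rsum_(k : F) (sn (a * k)%R * ct k).

(** For k <> 0, multiplying sin((a + 1) k) - sin(a k) by [ct k] gives cos((a + 1) k) + cos(a k),
    because (1 - c)(1 + c) = s^2. Orthogonality sums this; the -2 removes the term k = 0, where [ct]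
    is 0. *)
Lemma cot_sine_sum_succ (a : F) : cot_sine_sum (a + 1)%R =
  cot_sine_sum a + (INR p * ind (a + 1 == 0)%R + INR p * ind (a == 0%R) - 2).
Proof.
have -> : INR p * ind (a + 1 == 0)%R + INR p * ind (a == 0%R) - 2 =
    \rsum_(k : F) (cs ((a + 1) * k)%R + cs (a * k)%R - 2 * ind (k == 0%R)).
  by rewrite rsum_sub rsum_add !cs_orth // rsum_mull rsum_ind_eq0 Rmult_1_r.
rewrite /cot_sine_sum -rsum_add; apply: eq_bigr => k _.
have [->|k0] := eqVneq k 0%R; first by rewrite !mulr0 ct0 cs0 //=; ring.
rewrite mulrDl mul1r snD // csD // /ct /=; have c1 := cs_neq1 p_pr k0; have := cs2_sn2 k.
move: (cs k) (sn k) (cs (a * k)%R) (sn (a * k)%R) c1 => c s c' s' c1 h.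
apply: (Rmult_eq_reg_r (1 - c)); last by lra.
transitivity (s * s * c' + s' * c * s); first by field; lra.
have -> : s * s = 1 - c * c by lra.
by field; lra.
Qed.

Lemma cot_sine_sum_natr (n : nat) : (n < p)%N ->
  cot_sine_sum n%:R%R = if n == 0%N then 0 else INR p - 2 * INR n.
Proof.
elim: n => [|n IH] np.
  by rewrite eqxx; apply: rsum0 => k _; rewrite mul0r sn0 // Rmult_0_l.
rewrite -natr1 cot_sine_sum_succ IH; last exact: ltnW.
rewrite natr1 -[0%R]/(0%:R : F)%R !eq_natr_Fp // mod0n !modn_small //; last exact: ltnW.
rewrite S_INR; case: eqP => [->|_] /=; ring.
Qed.

Lemma sawF_fourier (a : F) : sawF a = - cot_sine_sum a / (2 * INR p).
Proof.
have p0 := INR_p_gt0 p_pr.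
rewrite -[in RHS](natr_Fp a) cot_sine_sum_natr ?ltn_Fp // /sawF -val_eqE /=.
by case: eqP => _; field; lra.
Qed.

Lemma sn_sn_orth (k l : F) : \rsum_(a : F) (sn (a * k)%R * sn (a * l)%R) =
  INR p / 2 * (ind (k == l) - ind (k == - l)%R).
Proof.
transitivity (1 / 2 * (\rsum_(a : F) cs ((k - l) * a)%R - \rsum_(a : F) cs ((k + l) * a)%R)).
  rewrite -rsum_sub -rsum_mull; apply: eq_bigr => a _.
  rewrite mulrBl mulrDl !csD // csN // snN // ![(_ * a)%R]mulrC.
  have aux (s t c d : R) : s * t = 1 / 2 * (c * d - s * - t - (c * d - s * t)) by lra.
  exact: aux.
have aux (q i j : R) : 1 / 2 * (q * i - q * j) = q / 2 * (i - j) by lra.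
by rewrite !cs_orth // subr_eq0 addr_eq0; apply: aux.
Qed.

(** Parseval applied to [sawF_fourier]. Orthogonality of sines selects k = h l and k = - h l, which
    contribute equally because [ct] is odd. *)
Lemma dedF_cot (h : F) : dedF h = / (4 * INR p) * \rsum_(l : F) (ct l * ct (h * l)%R).
Proof.
have p0 := INR_p_gt0 p_pr.
transitivity (\rsum_(a : F) \rsum_(l : F) \rsum_(k : F)
   (/ (4 * INR p ^ 2) * (ct l * (ct k * (sn (a * k)%R * sn (a * (h * l))%R))))).
  apply: eq_bigr => a _; rewrite !sawF_fourier.
  transitivity (/ (4 * INR p ^ 2) * (cot_sine_sum a * cot_sine_sum (a * h)%R)).
    have aux (x y : R) : - x / (2 * INR p) * (- y / (2 * INR p)) = / (4 * INR p ^ 2) * (x * y).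
      by field; lra.
    exact: aux.
  rewrite [X in _ * X]Rmult_comm -rsum_mulr -rsum_mull; apply: eq_bigr => l _.
  rewrite -!rsum_mull; apply: eq_bigr => k _; rewrite mulrA.
  have aux (x s t y z : R) : x * (s * t * (y * z)) = x * (t * (z * (y * s))) by ring.
  exact: aux.
rewrite exchange_big -rsum_mull; apply: eq_bigr => l _.
rewrite exchange_big /=.
transitivity (\rsum_(k : F) (/ (8 * INR p) * ct l *
    (ind (k == h * l)%R * ct k - ind (k == - (h * l))%R * ct k))).
  apply: eq_bigr => k _; rewrite !rsum_mull sn_sn_orth.
  have aux (x y i j : R) : / (4 * INR p ^ 2) * (x * (y * (INR p / 2 * (i - j)))) =
      / (8 * INR p) * x * (i * y - j * y) by field; lra.
  exact: aux.
rewrite rsum_mull rsum_sub !rsum_delta ctN.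
have aux (x y : R) : / (8 * INR p) * x * (y - - y) = / (4 * INR p) * (x * y) by field; lra.
exact: aux.
Qed.

Lemma dedF_odd (h : F) : dedF (- h)%R = - dedF h.
Proof.
rewrite !dedF_cot Ropp_mult_distr_r -rsum_opp; congr (_ * _); apply: eq_bigr => l _.
by rewrite mulNr ctN; apply: Ropp_mult_distr_r_reverse.
Qed.

Local Notation N := (p./2).

Lemma p_half : p = (N + N).+1.
Proof.
have := odd_double_half p; rewrite -addnn.
by have [p2|->] := even_prime p_pr; [move: p_gt3; rewrite p2 | ].
Qed.

Lemma rsum_half (f : F -> R) : \rsum_(x : F) f x =
  f 0%R + \rsum_(1 <= a < N.+1) (f a%:R%R + f (- a%:R)%R).
Proof.
rewrite (_ : \rsum_(x : F) f x = \rsum_(0 <= i < p) f i%:R%R); last first.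
  by rewrite rsum_Fp //; apply: eq_bigr => x _; rewrite natr_Fp.
have range_eq (g : nat -> R) M : p = M -> \rsum_(0 <= i < p) g i = \rsum_(0 <= i < M) g i.
  by move=> <-.
rewrite rsum_add (range_eq _ _ p_half) big_nat_recl //=; congr (_ + _).
rewrite (@big_cat_nat _ _ _ N) ?leq_addr //=; congr (_ + _).
  by rewrite [RHS]big_add1.
rewrite [RHS]big_add1 /= big_nat_rev /= -{1}[N]add0n big_addn addnK [RHS]big_nat.
rewrite big_nat; apply: eq_bigr => i /andP [_ iN].
congr f; apply/eqP; rewrite -addr_eq0 -natrD -[0%R]/(0%:R : F)%R eq_natr_Fp // mod0n.
have -> : ((N + (N + N) - (i + N).+1).+1 + i.+1 = p)%N; last by rewrite modnn.
by rewrite [RHS]p_half; lia.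
Qed.

Lemma dedF_half (h : F) : dedF h =
  / (2 * INR p) * \rsum_(1 <= a < N.+1) (ct (a%:R : F)%R * ct (h * a%:R)%R).
Proof.
have p0 := INR_p_gt0 p_pr.
rewrite dedF_cot rsum_half ct0 Rmult_0_l Rplus_0_l -!rsum_mull; apply: eq_bigr => a _.
rewrite mulrN !ctN.
have aux (x y : R) : / (4 * INR p) * (x * y + - x * - y) = / (2 * INR p) * (x * y) by field; lra.
exact: aux.
Qed.

Lemma natr_half_neq0 a : (1 <= a < N.+1)%N -> (a%:R != 0 :> F)%R.
Proof.
case/andP=> a1 aN; rewrite -[0%R]/(0%:R : F)%R eq_natr_Fp // mod0n modn_small.
  by rewrite -lt0n.
by rewrite [p]p_half; lia.
Qed.

Definition cw (a : nat) : R := PI / INR p * ct (a%:R : F)%R.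

(** Apply [x_cot_bounds] at x = pi a / p, which a < p / 2 keeps below pi / 2. The defect is at most
    pi^2 a / (2 p^2), and pi <= 4 turns pi^2 / 2 into 8. *)
Lemma cw_bounds a : (1 <= a < N.+1)%N ->
  0 <= cw a <= / INR a /\ / INR a - cw a <= 8 * INR a / INR p ^ 2.
Proof.
move=> aN; have p0 := INR_p_gt0 p_pr.
have a1 : 1 <= INR a by rewrite -[1]/(INR 1); apply: le_INR; apply/leP; case/andP: aN.
have ap : 2 * INR a <= INR p.
  rewrite -[2]/(INR 2) -mult_INR; apply: le_INR; apply/leP.
  by rewrite [X in (_ <= X)%N]p_half; lia.
have pi0 := PI_RGT_0; have pi4 := PI_4.
pose x := PI * INR a / INR p.
have x0 : 0 < x <= PI / 2.
  split; first by apply: Rdiv_lt_0_compat => //; apply: Rmult_lt_0_compat; lra.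
  by apply/Rle_div_l => //; nra.
have s0 : 0 < sin x by apply: sin_gt_0; lra.
have e : cw a = / INR a * (x * (cos x / sin x)).
  have -> : cw a = PI / INR p * (cos x / sin x).
    rewrite /cw /ct cs_natr // sn_natr //.
    have -> : 2 * PI * INR a / INR p = 2 * x by rewrite /x; field; lra.
    by rewrite sin_2a cos_2a_sin; field; split; nra.
  by rewrite /x; field; repeat split; rewrite -/x; lra.
have [[b1 b2] b3] := x_cot_bounds x0.
have ia : 0 < / INR a by apply: Rinv_0_lt_compat; lra.
rewrite e; split; first by split; [apply: Rmult_le_pos; lra | nra].
have h : / INR a * (x ^ 2 / 2) <= 8 * INR a / INR p ^ 2.
  have -> : / INR a * (x ^ 2 / 2) = PI ^ 2 / 2 * (INR a / INR p ^ 2) by rewrite /x; field; lra.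
  have -> : 8 * INR a / INR p ^ 2 = 8 * (INR a / INR p ^ 2) by field; lra.
  apply: Rmult_le_compat_r; last by nra.
  by apply: Rlt_le; apply: Rdiv_lt_0_compat; [lra | apply: pow_lt].
by nra.
Qed.

(** Square [dedF_half] and, for fixed a and c, substitute h = b / a. The cotangents become those of
    b and of b c / a, and b c / a equals d or -d for one d in the half range; oddness of [ct] puts
    that sign on the indicator. Since b and -b contribute equally, the constant is 2 / (4 p^2) times
    (p / pi)^4. *)
Lemma dedF_square_sum : \rsum_(h : F) dedF h ^ 2 =
  INR p ^ 2 / (2 * PI ^ 4) *
  \rsum_(1 <= a < N.+1) \rsum_(1 <= b < N.+1) \rsum_(1 <= c < N.+1) \rsum_(1 <= d < N.+1)
    ((ind (a * d == b * c %[mod p])%N - ind (p %| a * d + b * c)%N) *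
     (cw a * cw b * cw c * cw d)).
Proof.
have p0 := INR_p_gt0 p_pr; have pi0 := PI_RGT_0.
transitivity (/ (4 * INR p ^ 2) * \rsum_(1 <= a < N.+1) \rsum_(1 <= c < N.+1)
    (ct (a%:R : F)%R * ct (c%:R : F)%R *
     \rsum_(h : F) (ct (h * a%:R)%R * ct (h * c%:R)%R))).
  rewrite -rsum_mull.
  under [RHS]eq_bigr => a _ do rewrite -rsum_mull.
  under [RHS]eq_bigr => a _ do under eq_bigr => c _ do rewrite -2!rsum_mull.
  under [RHS]eq_bigr => a _ do rewrite exchange_big /=.
  rewrite [RHS]exchange_big /=; apply: eq_bigr => h _.
  rewrite Rmult_1_r dedF_half; set S := \rsum_(1 <= a < _) _.
  have -> : / (2 * INR p) * S * (/ (2 * INR p) * S) = / (4 * INR p ^ 2) * (S * S) by field; lra.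
  rewrite -rsum_mulr -rsum_mull; apply: eq_bigr => a _.
  rewrite -!rsum_mull; apply: eq_bigr => c _.
  have aux (x y u v w : R) : u * (x * y * (v * w)) = u * (x * v * (y * w)) by ring.
  exact: aux.
rewrite -!rsum_mull big_nat [RHS]big_nat; apply: eq_bigr => a aN.
have a0 := natr_half_neq0 aN.
rewrite [in RHS]exchange_big -!rsum_mull; apply: eq_bigr => c _.
have ct_nat x : ct (x%:R : F)%R = INR p / PI * cw x by rewrite /cw; field; lra.
have inner b : ct (b%:R / a%:R * c%:R : F)%R = \rsum_(1 <= d < N.+1)
    ((ind (a * d == b * c %[mod p])%N - ind (p %| a * d + b * c)%N) * ct (d%:R : F)%R).
  have solve (x : F) : (x == b%:R / a%:R * c%:R)%R = (a%:R * x == b%:R * c%:R)%R.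
    have e : (a%:R * (b%:R / a%:R * c%:R) = b%:R * c%:R :> F)%R.
      by rewrite mulrA [(a%:R * _)%R]mulrC divfK.
    by apply/eqP/eqP => [->|h] //; apply: (mulfI a0); rewrite h.
  rewrite -(rsum_delta (b%:R / a%:R * c%:R : F)%R) rsum_half ct0 Rmult_0_r Rplus_0_l.
  apply: eq_bigr => d _; rewrite ctN !solve mulrN -!natrM eqr_oppLR -addr_eq0 -natrD.
  rewrite -[0%R]/(0%:R : F)%R !eq_natr_Fp // mod0n.
  have aux (i j x : R) : i * x + j * - x = (i - j) * x by ring.
  exact: aux.
rewrite (reindex_inj (mulIf (invr_neq0 a0))) rsum_half !mul0r ct0 Rmult_0_l Rplus_0_l.
rewrite -2!rsum_mull -[RHS]rsum_mull; apply: eq_bigr => b _.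
rewrite !divfK // !mulNr !ctN inner !ct_nat.
under eq_bigr => d _ do rewrite ct_nat.
pose f d := ind (a * d == b * c %[mod p])%N - ind (p %| a * d + b * c)%N.
pose S := \rsum_(1 <= d < N.+1) (f d * cw d).
have e1 : \rsum_(1 <= d < N.+1) (f d * (INR p / PI * cw d)) = INR p / PI * S.
  by rewrite -rsum_mull; apply: eq_bigr => d _; ring.
have e2 : \rsum_(1 <= d < N.+1) (f d * (cw a * cw b * cw c * cw d)) =
    cw a * cw b * cw c * S.
  by rewrite -rsum_mull; apply: eq_bigr => d _; ring.
by rewrite e1 e2; field; lra.
Qed.
End Dedekind.

(** * zeta(2) and zeta(4) with a rate of convergence *)

Definition zsum (k N : nat) : R := \rsum_(1 <= n < N.+1) / INR n ^ k.

Lemma INR_ge1 n : (0 < n)%N -> 1 <= INR n.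
Proof. by move=> n0; rewrite -[1]/(INR 1); apply: le_INR; apply/leP. Qed.

(** Telescoping: 1 / (M + 1)^k <= 1 / (M + 1)^2 <= 1 / M - 1 / (M + 1). *)
Lemma zsum_tail k N M : (1 < k)%N -> (0 < N <= M)%N ->
  0 <= zsum k M - zsum k N <= / INR N - / INR M.
Proof.
move=> k1 /andP [N0]; elim: M => [|M IH]; first by rewrite leqn0 => /eqP N00; move: N0; rewrite N00.
rewrite leq_eqVlt => /orP [/eqP <-|NM]; first by lra.
have M0 : 1 <= INR M by apply: INR_ge1; apply: leq_trans N0 NM.
have rec : zsum k M.+1 = zsum k M + / INR M.+1 ^ k by rewrite /zsum big_nat_recr.
have := IH NM; rewrite rec.
set t := / _ ^ k.
have M1 : INR M.+1 = INR M + 1 by apply: S_INR.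
have t0 : 0 < t by apply: Rinv_0_lt_compat; apply: pow_lt; rewrite M1; lra.
have : t <= / INR M - / INR M.+1.
  apply: (@Rle_trans _ (/ INR M.+1 ^ 2)).
    apply: Rinv_le_contravar; first by apply: pow_lt; rewrite M1; lra.
    by apply: Rle_pow; [rewrite M1; lra | apply/leP].
  have -> : / INR M - / INR M.+1 = / (INR M * INR M.+1) by rewrite M1; field; lra.
  by apply: Rinv_le_contravar; rewrite M1; nra.
by move=> h1 h2; lra.
Qed.

Lemma ltn_exp2 n : (n < 2 ^ n)%N.
Proof. exact: ltn_expl. Qed.

(** The limit need only be known along N = 2^(n+1) - 1, the indices reached by angle halving;
    [zsum_tail] controls all others. *)
Lemma zsum_limit k (z C : R) : (1 < k)%N ->
  (forall n, Rabs (zsum k (2 ^ n.+1).-1 - z) <= C / 2 ^ n) ->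
  forall N, (0 < N)%N -> 0 <= z - zsum k N <= / INR N.
Proof.
move=> k1 lim N N0.
have approx eps : 0 < eps -> exists M, (N <= M)%N /\ Rabs (zsum k M - z) <= eps.
  move=> e0; have [n hn] := nfloor_ex (Rmax 0 (C / eps)) (Rmax_l _ _).
  exists (2 ^ (n + N).+1).-1; split; first by have := ltn_exp2 (n + N).+1; lia.
  apply: Rle_trans (lim (n + N)%N) _; apply/Rle_div_l; first by apply: pow_lt; lra.
  have : INR n.+1 <= 2 ^ (n + N).
    rewrite (_ : 2 ^ (n + N) = INR (2 ^ (n + N))%N); last first.
      by elim: (n + N)%N => [|m IH] //=; rewrite IH expnS mult_INR.
    by apply: le_INR; have := ltn_exp2 (n + N); lia.
  rewrite S_INR => h; have := Rmax_r 0 (C / eps) => h2.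
  have : C / eps <= 2 ^ (n + N) by lra.
  by move/(Rmult_le_compat_l eps _ _ (Rlt_le _ _ e0)); have -> : eps * (C / eps) = C by [field; lra].
have tail M : (N <= M)%N -> 0 <= zsum k M - zsum k N <= / INR N - / INR M.
  by move=> NM; apply: zsum_tail; rewrite ?N0.
have pos M : (N <= M)%N -> 0 < / INR M.
  by move=> NM; apply: Rinv_0_lt_compat; have := INR_ge1 (leq_trans N0 NM); lra.
split.
  suff : zsum k N <= z by lra.
  apply: le_epsilon => eps /approx [M [NM /Rabs_le_between h]].
  by have := tail _ NM; lra.
apply: le_epsilon => eps /approx [M [NM /Rabs_le_between h]].
by have := tail _ NM; have := pos _ NM; lra.
Qed.

(** * Euler's values of zeta(2) and zeta(4) by angle halving *)

Definition csc2 (x : R) : R := / (sin x ^ 2).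

(** With u = 1 / sin^2(x/2) and v = 1 / cos^2(x/2), Pythagoras gives u + v = u v = 4 / sin^2 x; the
    second identity is u^2 + v^2 = (u + v)^2 - 2 u v. *)
Lemma csc2_halving (x : R) : 0 < x < PI / 2 ->
  csc2 (x / 2) + csc2 (PI / 2 - x / 2) = 4 * csc2 x /\
  csc2 (x / 2) ^ 2 + csc2 (PI / 2 - x / 2) ^ 2 = 16 * csc2 x ^ 2 - 8 * csc2 x.
Proof.
move=> x0; rewrite /csc2 sin_shift.
have -> : sin x = 2 * sin (x / 2) * cos (x / 2) by rewrite -sin_2a; congr sin; lra.
have s0 : 0 < sin (x / 2) by apply: sin_gt_0; lra.
have c0 : 0 < cos (x / 2) by apply: cos_gt_0; lra.
have := sin2_cos2 (x / 2); rewrite /Rsqr.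
move: (sin _) (cos _) s0 c0 => s c s0 c0 h.
have s2 : s ^ 2 = 1 - c ^ 2 by lra.
have e : c ^ 2 + s ^ 2 = 1 by lra.
have first : / s ^ 2 + / c ^ 2 = / (s ^ 2 * c ^ 2).
  have -> : / s ^ 2 + / c ^ 2 = (c ^ 2 + s ^ 2) * / (s ^ 2 * c ^ 2) by field; lra.
  by rewrite e Rmult_1_l.
have q : / (2 * s * c) ^ 2 = / (s ^ 2 * c ^ 2) / 4 by field; lra.
have prod : / s ^ 2 * / c ^ 2 = / (s ^ 2 * c ^ 2) by field; lra.
rewrite q -first; split; first by lra.
have -> : (/ s ^ 2) ^ 2 + (/ c ^ 2) ^ 2 =
  (/ s ^ 2 + / c ^ 2) ^ 2 - 2 * (/ s ^ 2 * / c ^ 2) by ring.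
by rewrite prod -first; field; lra.
Qed.

(** This is cot^2 x <= 1 / x^2 <= csc^2 x, with cot^2 written as csc^2 - 1. *)
Lemma csc2_compare (x : R) : 0 < x < PI / 2 ->
  0 <= csc2 x - 1 <= (/ x) ^ 2 /\ (/ x) ^ 2 <= csc2 x.
Proof.
move=> x0; have s0 : 0 < sin x by apply: sin_gt_0; lra.
have c0 : 0 <= cos x by apply: cos_ge_0; lra.
have sx : sin x <= x by apply: Rlt_le; apply: sin_lt_x; lra.
have h1 : x * cos x <= sin x by apply: sin_ge_x_cos; lra.
have := sin2_cos2 x; rewrite /Rsqr => h; rewrite /csc2 -pow_inv.
have e : (/ sin x) ^ 2 - 1 = (cos x / sin x) ^ 2.
  have -> : (cos x / sin x) ^ 2 = (cos x * cos x) * (/ sin x) ^ 2 by field; lra.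
  have -> : cos x * cos x = 1 - sin x * sin x by lra.
  by field; lra.
have p0 : 0 <= cos x / sin x by apply: Rmult_le_pos => //; apply: Rlt_le; apply: Rinv_0_lt_compat.
split; last first.
  apply: pow_incr; split; first by apply: Rlt_le; apply: Rinv_0_lt_compat; lra.
  by apply: Rinv_le_contravar.
rewrite e; split; first exact: pow2_ge_0.
apply: pow_incr; split=> //.
apply: (Rmult_le_reg_r (x * sin x)); first by apply: Rmult_lt_0_compat; lra.
have -> : cos x / sin x * (x * sin x) = x * cos x by field; lra.
by have -> : / x * (x * sin x) = sin x by [field; lra].
Qed.

Definition angle (n k : nat) : R := PI * INR k / 2 ^ n.+1.
Definition csc_sum (i n : nat) : R := \rsum_(1 <= k < 2 ^ n) csc2 (angle n k) ^ i.

Lemma pow2_INR n : 2 ^ n = INR (2 ^ n)%N.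
Proof. by elim: n => [|m IH] //=; rewrite IH expnS mult_INR. Qed.

Lemma angle_bounds n k : (1 <= k < 2 ^ n)%N -> 0 < angle n k < PI / 2.
Proof.
move=> /andP [k1 kn]; have pi0 := PI_RGT_0; have p2 : 0 < 2 ^ n by apply: pow_lt; lra.
have k0 := INR_ge1 k1.
have k2 : INR k < 2 ^ n by rewrite pow2_INR; apply: lt_INR; apply/ltP.
rewrite /angle /=; split.
  by apply: Rdiv_lt_0_compat; nra.
have -> : PI / 2 = PI * 2 ^ n / (2 * 2 ^ n) by field; lra.
by apply: Rmult_lt_compat_r; [apply: Rinv_0_lt_compat; lra | nra].
Qed.

(** The angles at level n + 1 are the halves of those at level n, their mirror images in pi / 4, and
    pi / 4 itself, where csc^2 = 2 accounts for 2^i. *)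
Lemma csc_sum_rec i n : csc_sum i n.+1 =
  \rsum_(1 <= k < 2 ^ n) (csc2 (angle n k / 2) ^ i + csc2 (PI / 2 - angle n k / 2) ^ i)
  + 2 ^ i.
Proof.
have p2 : 0 < 2 ^ n by apply: pow_lt; lra.
have n1 : (0 < 2 ^ n)%N by rewrite expn_gt0.
have half k : angle n.+1 k = angle n k / 2 by rewrite /angle /=; field; lra.
rewrite /csc_sum (@big_cat_nat _ _ _ (2 ^ n)) //=; last by rewrite expnS; lia.
rewrite rsum_add Rplus_assoc; congr (_ + _); first by apply: eq_bigr => k _; rewrite half.
rewrite (@big_ltn _ _ _ (2 ^ n)); last by rewrite expnS; lia.
rewrite Rplus_comm; congr (_ + _); last first.
  have -> : angle n.+1 (2 ^ n) = PI / 4 by rewrite /angle -pow2_INR /=; field; lra.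
  congr (_ ^ i); rewrite /csc2 sin_PI4.
  have := sqrt_sqrt 2; have := sqrt_lt_R0 2; move: (sqrt 2) => s s0 s2.
  have -> : (1 / s) ^ 2 = / (s * s) by field; lra.
  by rewrite s2; [field|lra].
rewrite -[(2 ^ n).+1]add1n big_addn /= (_ : (2 ^ n.+1 - 2 ^ n = 2 ^ n)%N); last by rewrite expnS; lia.
rewrite big_nat_rev /= [LHS]big_nat [RHS]big_nat; apply: eq_bigr => k /andP [k1 k2].
congr (csc2 _ ^ i); rewrite half /angle.
have -> : (1 + 2 ^ n - k.+1 + 2 ^ n = 2 ^ n + 2 ^ n - k)%N by lia.
rewrite minus_INR ?plus_INR -?pow2_INR; last by lia.
by rewrite /=; field; lra.
Qed.

Lemma csc_sum1 n : csc_sum 1 n = 2 / 3 * (4 ^ n - 1).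
Proof.
elim: n => [|n IH]; first by rewrite /csc_sum big_geq //=; lra.
rewrite csc_sum_rec big_nat.
under eq_bigr => k hk do rewrite !pow_1 (proj1 (csc2_halving (angle_bounds hk))).
rewrite -big_nat rsum_mull; move: IH; rewrite /csc_sum.
under eq_bigr => k _ do rewrite pow_1.
by move=> ->; rewrite /=; lra.
Qed.

(** With U and V the sums of csc^2 and csc^4, halving gives U(n+1) = 4 U(n) + 2 and V(n+1) = 16 V(n)
    - 8 U(n) + 4; both start at 0, and the closed forms solve these recursions. *)
Lemma csc_sum2 n : csc_sum 2 n = 8 / 45 * 16 ^ n + 4 / 9 * 4 ^ n - 28 / 45.
Proof.
elim: n => [|n IH]; first by rewrite /csc_sum big_geq //=; lra.
rewrite csc_sum_rec big_nat.
under eq_bigr => k hk do rewrite (proj2 (csc2_halving (angle_bounds hk))).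
rewrite -big_nat rsum_sub !rsum_mull; move: (csc_sum1 n) IH; rewrite /csc_sum.
under eq_bigr => k _ do rewrite pow_1.
by move=> -> ->; rewrite /=; lra.
Qed.

Lemma zsum_csc (i n : nat) : zsum (i + i) (2 ^ n).-1 =
  (PI / (2 * 2 ^ n)) ^ (i + i) * \rsum_(1 <= k < 2 ^ n) ((/ angle n k) ^ 2) ^ i.
Proof.
have p2 : 0 < 2 ^ n by apply: pow_lt; lra.
have pi0 := PI_RGT_0.
rewrite /zsum prednK ?expn_gt0 // -rsum_mull [LHS]big_nat [RHS]big_nat.
apply: eq_bigr => k /andP [k1 _]; have k0 := INR_ge1 k1.
rewrite -pow_mult (_ : (2 * i)%coq_nat = (i + i)%N); last by lia.
rewrite -Rpow_mult_distr -pow_inv; congr (_ ^ _).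
by rewrite /angle /=; field; lra.
Qed.

(** By [csc2_compare] the rescaled partial sum lies between U - 2^m and U, with U = 2/3 (4^m - 1).
    The scale pi^2 / (4 * 4^m) gives the limit pi^2 / 6; the constant 100 is merely generous. *)
Lemma zeta2_rate N : (0 < N)%N -> 0 <= PI ^ 2 / 6 - zsum 2 N <= / INR N.
Proof.
apply: (@zsum_limit 2 _ 100) => // n.
rewrite (zsum_csc 1); set m := n.+1; set S := \rsum_(_ <= k < _) _.
have pi0 := PI_RGT_0; have pi4 := PI_4.
have p2 : 1 <= 2 ^ n by apply: pow_R1_Rle; lra.
have Xm : 2 ^ m = 2 * 2 ^ n by [].
have U : csc_sum 1 m = 2 / 3 * ((2 ^ m) ^ 2 - 1).
  by rewrite csc_sum1 -pow_mult Nat.mul_comm pow_mult (_ : 2 ^ 2 = 4) //; ring.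
have S1 : S <= csc_sum 1 m.
  rewrite /S /csc_sum; apply: rsum_nat_le => k kn; rewrite !pow_1.
  by have := csc2_compare (angle_bounds kn); lra.
have S2 : csc_sum 1 m - 2 ^ m <= S.
  have : csc_sum 1 m - \rsum_(1 <= k < 2 ^ m) 1 <= S.
    rewrite /S /csc_sum -rsum_sub; apply: rsum_nat_le => k kn; rewrite !pow_1.
    by have := csc2_compare (angle_bounds kn); lra.
  rewrite rsum_nat_const Rmult_1_r => h.
  have : INR (2 ^ m - 1)%N <= 2 ^ m by rewrite pow2_INR; apply: le_INR; lia.
  by lra.
move: S1 S2; rewrite U; move: S (2 ^ m) Xm => S X Xm S1 S2.
have X1 : 2 <= X by lra.
have e : (PI / (2 * X)) ^ (1 + 1) * S - PI ^ 2 / 6 =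
   PI ^ 2 / 4 * ((S - 2 / 3 * X ^ 2) / X ^ 2) by rewrite /=; field; lra.
rewrite e Rabs_mult Rabs_pos_eq; last by nra.
apply: (@Rle_trans _ (4 * (5 / (3 * X)))); last first.
  rewrite Xm; apply: (Rmult_le_reg_r (2 ^ n)); first by lra.
  by have -> : 100 / 2 ^ n * 2 ^ n = 100 by [field; lra];
     have -> : 4 * (5 / (3 * (2 * 2 ^ n))) * 2 ^ n = 10 / 3 by [field; lra]; lra.
apply: Rmult_le_compat; [nra | exact: Rabs_pos | nra |].
have -> : 5 / (3 * X) = (5 / 3 * X) / X ^ 2 by field; lra.
rewrite Rabs_mult (Rabs_pos_eq (/ _)); last by apply: Rlt_le; apply: Rinv_0_lt_compat; nra.
apply: Rmult_le_compat_r; first by apply: Rlt_le; apply: Rinv_0_lt_compat; nra.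
by apply: Rabs_le; lra.
Qed.

(** The same sandwich, squared: csc^4 - 2 csc^2 <= (csc^2 - 1)^2 <= 1 / x^4 <= csc^4. The limit is
    pi^4 / 16 times 8 / 45. *)
Lemma zeta4_rate N : (0 < N)%N -> 0 <= PI ^ 4 / 90 - zsum 4 N <= / INR N.
Proof.
apply: (@zsum_limit 4 _ 100) => // n.
rewrite (zsum_csc 2); set m := n.+1; set S := \rsum_(_ <= k < _) _.
have pi0 := PI_RGT_0; have pi4 := PI_4.
have p2 : 1 <= 2 ^ n by apply: pow_R1_Rle; lra.
have Xm : 2 ^ m = 2 * 2 ^ n by [].
have four : 4 ^ m = (2 ^ m) ^ 2 by rewrite -pow_mult Nat.mul_comm pow_mult (_ : 2 ^ 2 = 4) //; ring.
have sixteen : 16 ^ m = (2 ^ m) ^ 4 by rewrite -pow_mult Nat.mul_comm pow_mult (_ : 2 ^ 4 = 16) //; ring.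
have U : csc_sum 1 m = 2 / 3 * ((2 ^ m) ^ 2 - 1) by rewrite csc_sum1 four.
have V : csc_sum 2 m = 8 / 45 * (2 ^ m) ^ 4 + 4 / 9 * (2 ^ m) ^ 2 - 28 / 45.
  by rewrite csc_sum2 four sixteen.
have S1 : S <= csc_sum 2 m.
  rewrite /S /csc_sum; apply: rsum_nat_le => k kn.
  apply: pow_incr; split; first exact: pow2_ge_0.
  by have := csc2_compare (angle_bounds kn); lra.
have S2 : csc_sum 2 m - 2 * csc_sum 1 m <= S.
  rewrite /S /csc_sum -rsum_mull -rsum_sub; apply: rsum_nat_le => k kn; rewrite pow_1.
  have [[h1 h2] h3] := csc2_compare (angle_bounds kn).
  move: (csc2 _) (_ ^ 2) h1 h2 h3 => t u h1 h2 h3.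
  by have := Rmult_le_compat _ _ _ _ h1 h1 h2 h2; rewrite /=; nra.
move: S1 S2; rewrite U V; move: S (2 ^ m) Xm => S X Xm S1 S2.
have X1 : 2 <= X by lra.
have e : (PI / (2 * X)) ^ (2 + 2) * S - PI ^ 4 / 90 =
   PI ^ 4 / 16 * ((S - 8 / 45 * X ^ 4) / X ^ 4) by rewrite /=; field; lra.
have p4 : 0 <= PI ^ 4 / 16 <= 16.
  split; first by apply: Rmult_le_pos; [apply: pow_le; lra | lra].
  by have := pow_incr PI 4 4 (conj (Rlt_le _ _ pi0) pi4); lra.
have X4 : 0 < X ^ 4 by apply: pow_lt; lra.
have X2 : 4 <= X ^ 2 by nra.
rewrite e Rabs_mult Rabs_pos_eq; last by lra.
apply: (@Rle_trans _ (16 * (2 / X ^ 2))); last first.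
  apply: (@Rle_trans _ (16 * (2 / X))); last first.
    rewrite Xm; apply: (Rmult_le_reg_r (2 ^ n)); first by lra.
    by have -> : 100 / 2 ^ n * 2 ^ n = 100 by [field; lra];
       have -> : 16 * (2 / (2 * 2 ^ n)) * 2 ^ n = 16 by [field; lra]; lra.
  apply: Rmult_le_compat_l; first by lra.
  apply: Rmult_le_compat_l; first by lra.
  by apply: Rinv_le_contravar; nra.
apply: Rmult_le_compat; [lra | exact: Rabs_pos | lra |].
have -> : 2 / X ^ 2 = (2 * X ^ 2) / X ^ 4 by field; lra.
rewrite Rabs_mult (Rabs_pos_eq (/ _)); last by apply: Rlt_le; apply: Rinv_0_lt_compat.
apply: Rmult_le_compat_r; first by apply: Rlt_le; apply: Rinv_0_lt_compat.
by apply: Rabs_le; lra.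
Qed.

(** * Sums over proportional pairs *)

Section NatSums.
Variable N : nat.
Implicit Types f g : nat -> nat -> nat -> nat -> R.

Definition sum4 f : R := \rsum_(1 <= a < N.+1) \rsum_(1 <= b < N.+1)
  \rsum_(1 <= c < N.+1) \rsum_(1 <= d < N.+1) f a b c d.

Lemma sum4_le f g :
  (forall a b c d, (0 < a <= N)%N -> (0 < b <= N)%N -> (0 < c <= N)%N ->
     (0 < d <= N)%N -> f a b c d <= g a b c d) -> sum4 f <= sum4 g.
Proof.
move=> fg; apply: rsum_nat_le => a ha; apply: rsum_nat_le => b hb.
by apply: rsum_nat_le => c hc; apply: rsum_nat_le => d hd; apply: fg.
Qed.

Lemma eq_sum4 f g :
  (forall a b c d, (0 < a <= N)%N -> (0 < b <= N)%N -> (0 < c <= N)%N ->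
     (0 < d <= N)%N -> f a b c d = g a b c d) -> sum4 f = sum4 g.
Proof. by move=> fg; apply: Rle_antisym; apply: sum4_le => *; rewrite fg //; lra. Qed.

Lemma sum4_add f g : sum4 (fun a b c d => f a b c d + g a b c d) = sum4 f + sum4 g.
Proof.
rewrite /sum4 -rsum_add; apply: eq_bigr => a _; rewrite -rsum_add; apply: eq_bigr => b _.
by rewrite -rsum_add; apply: eq_bigr => c _; rewrite -rsum_add.
Qed.

Lemma sum4_mull k f : sum4 (fun a b c d => k * f a b c d) = k * sum4 f.
Proof.
rewrite /sum4 -rsum_mull; apply: eq_bigr => a _; rewrite -rsum_mull; apply: eq_bigr => b _.
by rewrite -rsum_mull; apply: eq_bigr => c _; rewrite -rsum_mull.
Qed.

Lemma sum4_sub f g : sum4 (fun a b c d => f a b c d - g a b c d) = sum4 f - sum4 g.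
Proof.
rewrite /sum4 -rsum_sub; apply: eq_bigr => a _; rewrite -rsum_sub; apply: eq_bigr => b _.
by rewrite -rsum_sub; apply: eq_bigr => c _; rewrite -rsum_sub.
Qed.

Lemma sum4_big (I : Type) (r : seq I) (F : I -> nat -> nat -> nat -> nat -> R) :
  sum4 (fun a b c d => \rsum_(i <- r) F i a b c d) = \rsum_(i <- r) sum4 (F i).
Proof.
rewrite /sum4 [RHS]exchange_big; apply: eq_bigr => a _.
rewrite [RHS]exchange_big; apply: eq_bigr => b _.
rewrite [RHS]exchange_big; apply: eq_bigr => c _.
by rewrite [RHS]exchange_big.
Qed.

Lemma sum4_swap12 f : sum4 f = sum4 (fun b a c d => f a b c d).
Proof. by rewrite /sum4 exchange_big. Qed.

Lemma sum4_swap23 f : sum4 f = sum4 (fun a c b d => f a b c d).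
Proof. by apply: eq_bigr => a _; rewrite exchange_big. Qed.

Lemma sum4_swap34 f : sum4 f = sum4 (fun a b d c => f a b c d).
Proof. by apply: eq_bigr => a _; apply: eq_bigr => b _; rewrite exchange_big. Qed.

End NatSums.

Lemma rsum_delta_nat (N m : nat) (F : nat -> R) : (0 < m)%N ->
  \rsum_(1 <= i < N.+1) (ind (i == m) * F i) = ind (m <= N)%N * F m.
Proof.
move=> m0; elim: N => [|N IH].
  by rewrite big_geq // leqNgt m0 /=; ring.
rewrite big_nat_recr // IH /= [(m <= N.+1)%N]leq_eqVlt ltnS eq_sym.
case: eqP => [->|_] /=; last by ring.
by rewrite ltnn /=; ring.
Qed.

Definition harm (N : nat) : R := \rsum_(1 <= n < N.+1) / INR n.

Lemma zsum_div (k N t : nat) : (0 < t)%N ->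
  \rsum_(1 <= g < N.+1) (ind (g * t <= N)%N * / INR g ^ k) = zsum k (N %/ t).
Proof.
move=> t0; have le : ((N %/ t).+1 <= N.+1)%N by rewrite ltnS leq_div.
rewrite (@big_cat_nat _ _ _ (N %/ t).+1) //=.
rewrite [X in _ + X]big_nat [X in _ + X]rsum0 ?Rplus_0_r; last first.
  move=> g /andP [g1 _]; suff -> : (g * t <= N)%N = false by rewrite /=; ring.
  by apply/negbTE; rewrite -ltnNge -ltn_divLR.
rewrite big_nat [RHS]big_nat; apply: eq_bigr => g /andP [_ g1].
suff -> : (g * t <= N)%N by rewrite /=; ring.
by rewrite -leq_divRL.
Qed.

Section CoprimeDecomposition.
Variable N : nat.

(** A partition of unity to be inserted into sums: (a, b) = g (x, y) with x, y coprime in exactly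
    one way, namely g = gcd(a, b). *)
Lemma coprime_decomposition a b : (0 < a <= N)%N -> (0 < b <= N)%N ->
  \rsum_(1 <= x < N.+1) \rsum_(1 <= y < N.+1) \rsum_(1 <= g < N.+1)
    (ind (coprime x y) * (ind (a == g * x)%N * ind (b == g * y)%N)) = 1.
Proof.
case/andP=> a0 aN /andP [b0 bN].
have g0 : (0 < gcdn a b)%N by rewrite gcdn_gt0 a0.
have xa : ((a %/ gcdn a b) * gcdn a b = a)%N by rewrite divnK // dvdn_gcdl.
have yb : ((b %/ gcdn a b) * gcdn a b = b)%N by rewrite divnK // dvdn_gcdr.
have x0 : (0 < a %/ gcdn a b)%N by rewrite divn_gt0 // dvdn_leq // dvdn_gcdl.
have y0 : (0 < b %/ gcdn a b)%N by rewrite divn_gt0 // dvdn_leq // dvdn_gcdr.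
have cop : coprime (a %/ gcdn a b) (b %/ gcdn a b).
  by rewrite /coprime -(eqn_pmul2r g0) muln_gcdl xa yb mul1n.
transitivity (\rsum_(1 <= x < N.+1) (ind (x == a %/ gcdn a b)%N *
   \rsum_(1 <= y < N.+1) (ind (y == b %/ gcdn a b)%N *
   \rsum_(1 <= g < N.+1) (ind (g == gcdn a b) * 1)))); last first.
  rewrite !rsum_delta_nat // !(leq_trans (leq_div _ _)) //=.
  by rewrite (leq_trans _ aN) /=; [ring | rewrite dvdn_leq // dvdn_gcdl].
apply: eq_bigr => x _; rewrite -rsum_mull; apply: eq_bigr => y _.
rewrite -!rsum_mull big_nat [RHS]big_nat; apply: eq_bigr => g /andP [g1 _].
have -> : ind (coprime x y) * (ind (a == g * x)%N * ind (b == g * y)%N) =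
    ind [&& coprime x y, a == g * x & b == g * y]%N.
  by case: coprime; case: (_ == _); case: (_ == _) => /=; ring.
have -> : ind (x == a %/ gcdn a b)%N * (ind (y == b %/ gcdn a b)%N * (ind (g == gcdn a b) * 1))
   = ind [&& x == a %/ gcdn a b, y == b %/ gcdn a b & g == gcdn a b]%N.
  by case: (_ == _); case: (_ == _); case: (_ == _) => /=; ring.
congr ind; apply/and3P/and3P => [[c /eqP ha /eqP hb]|[/eqP -> /eqP -> /eqP ->]]; last first.
  by split=> //; rewrite mulnC ?xa ?yb.
have gg : gcdn a b = g by rewrite ha hb -muln_gcdr (eqP c) muln1.
by rewrite gg ha hb !mulKn.
Qed.

Lemma rsum_coprime (f : nat -> nat -> R) :
  \rsum_(1 <= a < N.+1) \rsum_(1 <= b < N.+1) f a b =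
  \rsum_(1 <= x < N.+1) \rsum_(1 <= y < N.+1) (ind (coprime x y) *
    \rsum_(1 <= g < N.+1) (ind (g * maxn x y <= N)%N * f (g * x)%N (g * y)%N)).
Proof.
transitivity (\rsum_(1 <= a < N.+1) \rsum_(1 <= b < N.+1)
  \rsum_(1 <= x < N.+1) \rsum_(1 <= y < N.+1) \rsum_(1 <= g < N.+1)
    (ind (coprime x y) * (ind (a == g * x)%N * ind (b == g * y)%N * f a b))).
  rewrite big_nat [RHS]big_nat; apply: eq_bigr => a ha.
  rewrite big_nat [RHS]big_nat; apply: eq_bigr => b hb.
  rewrite -[LHS]Rmult_1_l -(coprime_decomposition ha hb) -rsum_mulr; apply: eq_bigr => x _.
  rewrite -rsum_mulr; apply: eq_bigr => y _; rewrite -rsum_mulr; apply: eq_bigr => g _.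
  by ring.
under eq_bigr => a _ do rewrite exchange_big /=.
rewrite exchange_big /= big_nat [RHS]big_nat; apply: eq_bigr => x /andP [x0 _].
under eq_bigr => a _ do rewrite exchange_big /=.
rewrite exchange_big /= big_nat [RHS]big_nat; apply: eq_bigr => y /andP [y0 _].
under eq_bigr => a _ do rewrite exchange_big /=.
rewrite exchange_big /= -rsum_mull big_nat [RHS]big_nat; apply: eq_bigr => g /andP [g0 _].
transitivity (ind (coprime x y) * \rsum_(1 <= a < N.+1) (ind (a == g * x)%N *
    \rsum_(1 <= b < N.+1) (ind (b == g * y)%N * f a b))).
  rewrite -rsum_mull; apply: eq_bigr => a _; rewrite -!rsum_mull; apply: eq_bigr => b _.
  by ring.
rewrite !rsum_delta_nat ?muln_gt0 ?g0 // maxnMr geq_max.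
by case: (_ <= _)%N; case: (_ <= _)%N => /=; ring.
Qed.

(** For (a, b) = g (x, y) the equation a d = b c reads x d = y c; coprimality makes x divide c, so
    (c, d) = h (x, y). *)
Lemma proportional_pairs x y g c d : coprime x y -> (0 < x)%N -> (0 < g)%N ->
  (0 < c <= N)%N -> (0 < d <= N)%N ->
  ind (g * x * d == g * y * c)%N =
  \rsum_(1 <= h < N.+1) (ind (c == h * x)%N * ind (d == h * y)%N).
Proof.
move=> cop x0 g0 /andP [c0 cN] /andP [d0 dN].
rewrite -!mulnA eqn_pmul2l //.
case: (boolP (x %| c)) => [/dvdnP [h ch]|xc]; last first.
  rewrite rsum0 => [|h _]; last first.
    by case: eqP => [e|_] /=; [rewrite e dvdn_mull in xc | ring].
  case: eqP => // e; case/negP: xc.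
  by rewrite -(Gauss_dvdr c cop) -e dvdn_mulr.
have h0 : (0 < h)%N by move: c0; rewrite ch muln_gt0 => /andP [].
have hN : (h <= N)%N by apply: leq_trans cN; rewrite ch leq_pmulr.
transitivity (\rsum_(1 <= k < N.+1) (ind (k == h) * ind (d == k * y)%N)).
  rewrite rsum_delta_nat // hN /= Rmult_1_l; congr ind.
  by rewrite ch mulnCA mulnC [(h * (y * x))%N]mulnA eqn_pmul2r.
apply: eq_bigr => k _; congr (ind _ * _).
by rewrite ch eqn_pmul2r // eq_sym.
Qed.

End CoprimeDecomposition.

(** * The main term *)

Definition Gsum (N : nat) : R :=
  sum4 N (fun a b c d => ind (a * d == b * c)%N * (/ INR a * / INR b * (/ INR c * / INR d))).

Lemma maxn_gt0_l x y : (0 < x)%N -> (0 < maxn x y)%N.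
Proof. by move=> x0; rewrite (leq_trans x0) // leq_maxl. Qed.

(** Both pairs are multiples g (x, y) and h (x, y) of one coprime pair, so the weight is 1 / (x y g
    h)^2, and g and h run independently up to N / max(x, y). *)
Lemma Gsum_coprime N : Gsum N =
  \rsum_(1 <= x < N.+1) \rsum_(1 <= y < N.+1) (ind (coprime x y) *
    (/ (INR x * INR y) ^ 2 * zsum 2 (N %/ maxn x y) ^ 2)).
Proof.
rewrite /Gsum /sum4 rsum_coprime big_nat [RHS]big_nat; apply: eq_bigr => x /andP [x0 _].
rewrite big_nat [RHS]big_nat; apply: eq_bigr => y /andP [y0 _].
case cop: (coprime x y); last by rewrite /= !Rmult_0_l.
have x1 := INR_ge1 x0; have y1 := INR_ge1 y0.
congr (_ * _); have m0 := maxn_gt0_l y x0.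
transitivity (\rsum_(1 <= g < N.+1) (ind (g * maxn x y <= N)%N * / INR g ^ 2 *
   (/ (INR x * INR y) ^ 2 * zsum 2 (N %/ maxn x y)))); last first.
  by rewrite rsum_mulr zsum_div //; ring.
rewrite big_nat [RHS]big_nat; apply: eq_bigr => g /andP [g0 _].
have g1 := INR_ge1 g0; rewrite Rmult_assoc; congr (_ * _).
transitivity (/ INR (g * x) * / INR (g * y) * \rsum_(1 <= c < N.+1) \rsum_(1 <= d < N.+1)
    \rsum_(1 <= h < N.+1) (ind (c == h * x)%N * (ind (d == h * y)%N * (/ INR c * / INR d)))).
  rewrite -rsum_mull big_nat [RHS]big_nat; apply: eq_bigr => c hc.
  rewrite -rsum_mull big_nat [RHS]big_nat; apply: eq_bigr => d hd.
  rewrite (proportional_pairs cop x0 g0 hc hd) -rsum_mulr -rsum_mull; apply: eq_bigr => h _.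
  by ring.
under eq_bigr => c _ do rewrite exchange_big /=.
rewrite exchange_big /=.
rewrite (_ : \rsum_(1 <= h < N.+1) _ = / (INR x * INR y) * zsum 2 (N %/ maxn x y)); last first.
  rewrite -zsum_div // -rsum_mull big_nat [RHS]big_nat; apply: eq_bigr => h /andP [h0 _].
  have h1 := INR_ge1 h0.
  transitivity (\rsum_(1 <= c < N.+1) (ind (c == h * x)%N * (/ INR c *
     \rsum_(1 <= d < N.+1) (ind (d == h * y)%N * / INR d)))).
    apply: eq_bigr => c _; rewrite -!rsum_mull; apply: eq_bigr => d _; ring.
  rewrite !rsum_delta_nat ?muln_gt0 ?h0 // maxnMr geq_max !mult_INR.
  by case: (_ <= _)%N; case: (_ <= _)%N => /=; field; lra.
by rewrite !mult_INR; field; lra.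
Qed.

(** Here only one scale g occurs, with weight 1 / g^4. Comparing with [Gsum_coprime] term by term
    evaluates [Gsum] without a separate treatment of the sum over coprime pairs. *)
Lemma zsum2_square_coprime N : zsum 2 N ^ 2 =
  \rsum_(1 <= x < N.+1) \rsum_(1 <= y < N.+1) (ind (coprime x y) *
    (/ (INR x * INR y) ^ 2 * zsum 4 (N %/ maxn x y))).
Proof.
transitivity (\rsum_(1 <= a < N.+1) \rsum_(1 <= b < N.+1) (/ INR a ^ 2 * / INR b ^ 2)).
  rewrite /= Rmult_1_r {1}/zsum -rsum_mulr; apply: eq_bigr => a _.
  by rewrite -rsum_mull.
rewrite rsum_coprime big_nat [RHS]big_nat; apply: eq_bigr => x /andP [x0 _].
rewrite big_nat [RHS]big_nat; apply: eq_bigr => y /andP [y0 _].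
have x1 := INR_ge1 x0; have y1 := INR_ge1 y0.
rewrite -zsum_div ?maxn_gt0_l //; congr (_ * _).
rewrite -rsum_mull big_nat [RHS]big_nat; apply: eq_bigr => g /andP [g0 _]; have g1 := INR_ge1 g0.
by rewrite !mult_INR; field; lra.
Qed.

Lemma zsum_ge0 k N : 0 <= zsum k N.
Proof.
rewrite /zsum big_nat; apply: rsum_ge0 => n /andP [n0 _]; have n1 := INR_ge1 n0.
by apply: Rlt_le; apply: Rinv_0_lt_compat; apply: pow_lt; lra.
Qed.

Lemma harm_ge1 N : (0 < N)%N -> 1 <= harm N.
Proof.
move=> N0; rewrite /harm big_ltn //= Rinv_1.
have : 0 <= \rsum_(2 <= n < N.+1) / INR n; last by lra.
rewrite big_nat; apply: rsum_ge0 => n /andP [n0 _].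
by apply: Rlt_le; apply: Rinv_0_lt_compat; apply: lt_0_INR; lia.
Qed.

Lemma zeta2_le : PI ^ 2 / 6 <= 8 / 3.
Proof. by have := PI_4; have := PI_RGT_0; nra. Qed.

Lemma zsum2_le N : (0 < N)%N -> zsum 2 N <= 8 / 3.
Proof. by move=> N0; have := zeta2_rate N0; have := zeta2_le; lra. Qed.

(* 5/2 = zeta(2)^2 / zeta(4). *)
Lemma zsum_ratio t : (0 < t)%N -> Rabs (zsum 2 t ^ 2 - 5 / 2 * zsum 4 t) <= 8 / INR t.
Proof.
move=> t0; have [a1 a2] := zeta2_rate t0; have [b1 b2] := zeta4_rate t0.
have z := zeta2_le; have z2 := zsum_ge0 2 t.
have i0 : 0 < / INR t by apply: Rinv_0_lt_compat; have := INR_ge1 t0; lra.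
have e : zsum 2 t ^ 2 - 5 / 2 * zsum 4 t =
  5 / 2 * (PI ^ 4 / 90 - zsum 4 t) - (PI ^ 2 / 6 - zsum 2 t) * (PI ^ 2 / 6 + zsum 2 t) by field.
have h : 0 <= (PI ^ 2 / 6 - zsum 2 t) * (PI ^ 2 / 6 + zsum 2 t) <= / INR t * (16 / 3).
  split; first by apply: Rmult_le_pos; lra.
  by apply: Rmult_le_compat; lra.
by rewrite e /Rdiv; apply: Rabs_le; lra.
Qed.

(** The termwise comparison with 5/2 [zsum 2 N ^ 2] costs 32 [harm N] [zsum 2 N] / N, and [zsum 2 N]
    <= 8/3 makes this 86 [harm N] / N. Replacing [zsum 2 N] by pi^2 / 6 costs 5/2 * 16/3 < 14 more
    over N. *)
Lemma Gsum_rate N : (0 < N)%N ->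
  Rabs (Gsum N - 5 * PI ^ 4 / 72) <= 120 * harm N / INR N.
Proof.
move=> N0; have H1 := harm_ge1 N0; have N1 := INR_ge1 N0.
have iN : 0 < / INR N by apply: Rinv_0_lt_compat; lra.
have part1 : Rabs (Gsum N - 5 / 2 * zsum 2 N ^ 2) <= 86 * harm N / INR N.
  rewrite Gsum_coprime zsum2_square_coprime -rsum_mull -rsum_sub.
  apply: Rle_trans (rsum_abs _ _ _) _.
  apply: (@Rle_trans _ (\rsum_(1 <= x < N.+1) \rsum_(1 <= y < N.+1)
     (16 / INR N * (/ INR x * / INR y ^ 2 + / INR x ^ 2 * / INR y)))).
    apply: rsum_nat_le => x /andP [x0 xN]; rewrite -rsum_mull -rsum_sub.
    apply: Rle_trans (rsum_abs _ _ _) _; apply: rsum_nat_le => y /andP [y0 yN].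
    have x1 := INR_ge1 x0; have y1 := INR_ge1 y0.
    set m := maxn x y; have m0 : (0 < m)%N := maxn_gt0_l y x0.
    have mN : (m <= N)%N by rewrite geq_max; move: xN yN; rewrite !ltnS => -> ->.
    set t := (N %/ m)%N; have t0 : (0 < t)%N by rewrite divn_gt0.
    (* As t >= 1, rounding N / m down to t loses at most a factor 2. *)
    have tN : INR N <= 2 * INR t * INR m.
      rewrite -[2]/(INR 2) -!mult_INR; apply: le_INR; apply/leP.
      by have := ltn_ceil N m0; rewrite -/t; nia.
    have mxy : INR m <= INR x + INR y.
      by rewrite -plus_INR; apply: le_INR; rewrite /m; lia.
    have t1 := INR_ge1 t0; have m1 := INR_ge1 m0.
    set u := / (INR x * INR y) ^ 2.
    have u0 : 0 < u by apply: Rinv_0_lt_compat; apply: pow_lt; nra.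
    have -> : ind (coprime x y) * (u * zsum 2 t ^ 2) - 5 / 2 * (ind (coprime x y) * (u * zsum 4 t)) =
       ind (coprime x y) * u * (zsum 2 t ^ 2 - 5 / 2 * zsum 4 t) by ring.
    have c01 : 0 <= ind (coprime x y) * u <= u.
      by have := ind_ge0 (coprime x y); have := ind_le1 (coprime x y); nra.
    rewrite Rabs_mult (Rabs_pos_eq (_ * u)); last by lra.
    have r := zsum_ratio t0.
    have t2 : 8 / INR t <= 16 / INR N * (INR x + INR y).
      apply: (Rmult_le_reg_r (INR t * INR N)); first by nra.
      have -> : 8 / INR t * (INR t * INR N) = 8 * INR N by field; lra.
      have -> : 16 / INR N * (INR x + INR y) * (INR t * INR N) =
        16 * (INR t * (INR x + INR y)) by field; lra.
      by nra.
    apply: (@Rle_trans _ (u * (16 / INR N * (INR x + INR y)))).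
      by apply: Rmult_le_compat; [lra | exact: Rabs_pos | lra | lra].
    by apply: Req_le; rewrite /u; field; lra.
  have -> : \rsum_(1 <= x < N.+1) \rsum_(1 <= y < N.+1)
     (16 / INR N * (/ INR x * / INR y ^ 2 + / INR x ^ 2 * / INR y)) =
     16 / INR N * (2 * (harm N * zsum 2 N)).
    transitivity (16 / INR N * (harm N * zsum 2 N + zsum 2 N * harm N)); last by ring.
    rewrite {1}/harm {2}/zsum -!rsum_mulr -rsum_add -rsum_mull; apply: eq_bigr => x _.
    by rewrite /zsum /harm -!rsum_mull -rsum_add -rsum_mull.
  have z := zsum2_le N0; have z0 := zsum_ge0 2 N.
  have : harm N * zsum 2 N <= harm N * (8 / 3) by apply: Rmult_le_compat_l; lra.
  by move=> h; rewrite /Rdiv; nra.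
have [a1 a2] := zeta2_rate N0; have z := zeta2_le; have z2 := zsum_ge0 2 N.
have h : 0 <= (PI ^ 2 / 6 - zsum 2 N) * (PI ^ 2 / 6 + zsum 2 N) <= / INR N * (16 / 3).
  split; first by apply: Rmult_le_pos; lra.
  by apply: Rmult_le_compat; lra.
have e : Gsum N - 5 * PI ^ 4 / 72 = (Gsum N - 5 / 2 * zsum 2 N ^ 2) -
  5 / 2 * ((PI ^ 2 / 6 - zsum 2 N) * (PI ^ 2 / 6 + zsum 2 N)) by field.
move/Rabs_le_between: part1 => part1; rewrite e; apply: Rabs_le.
have : / INR N <= harm N / INR N by rewrite -{1}[/ INR N]Rmult_1_l; apply: Rmult_le_compat_r; lra.
have -> : 120 * harm N / INR N = 120 * (harm N / INR N) by field; lra.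
have e3 : 86 * harm N / INR N = 86 * (harm N / INR N) by field; lra.
rewrite e3 in part1.
by lra.
Qed.

(** * The error terms *)

(** Replace one factor at a time, then enlarge each remaining w to the corresponding u. *)
Lemma prod4_diff (u1 u2 u3 u4 w1 w2 w3 w4 : R) :
  0 <= w1 <= u1 -> 0 <= w2 <= u2 -> 0 <= w3 <= u3 -> 0 <= w4 <= u4 ->
  0 <= u1 * u2 * (u3 * u4) - w1 * w2 * (w3 * w4) <=
  (u1 - w1) * (u2 * u3 * u4) + (u2 - w2) * (u1 * u3 * u4) +
  (u3 - w3) * (u1 * u2 * u4) + (u4 - w4) * (u1 * u2 * u3).
Proof.
move=> h1 h2 h3 h4.
have m (x y x' y' : R) : 0 <= x <= x' -> 0 <= y <= y' -> 0 <= x * y <= x' * y'.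
  by move=> hx hy; split; [apply: Rmult_le_pos | apply: Rmult_le_compat]; lra.
have -> : u1 * u2 * (u3 * u4) - w1 * w2 * (w3 * w4) =
  (u1 - w1) * (u2 * u3 * u4) + (u2 - w2) * (w1 * u3 * u4) +
  (u3 - w3) * (w1 * w2 * u4) + (u4 - w4) * (w1 * w2 * w3) by ring.
have p1 : 0 <= (u1 - w1) * (u2 * u3 * u4).
  by repeat apply: Rmult_le_pos; lra.
have p2 : 0 <= (u2 - w2) * (w1 * u3 * u4) <= (u2 - w2) * (u1 * u3 * u4).
  by apply: (m); first lra; apply: (m); last lra; apply: (m); lra.
have p3 : 0 <= (u3 - w3) * (w1 * w2 * u4) <= (u3 - w3) * (u1 * u2 * u4).
  by apply: (m); first lra; apply: (m); last lra; apply: (m); lra.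
have p4 : 0 <= (u4 - w4) * (w1 * w2 * w3) <= (u4 - w4) * (u1 * u2 * u3).
  by apply: (m); first lra; apply: (m); last lra; apply: (m); lra.
by lra.
Qed.

Section ErrorTerms.
Variables (p N : nat) (D : R) (w : nat -> R).
Hypothesis pN : p = (N + N).+1.
Hypothesis N_gt0 : (0 < N)%N.
Hypothesis D_ge1 : 1 <= D.
Hypothesis count_factorizations : forall n,
  \rsum_(1 <= b < N.+1) \rsum_(1 <= c < N.+1) ind (n == b * c)%N <= D.
Hypothesis w_bounds : forall a, (0 < a <= N)%N ->
  0 <= w a <= / INR a /\ / INR a - w a <= 8 * INR a / INR p ^ 2.

Let wt a b c d := w a * w b * (w c * w d).
Let ut a b c d := / INR a * / INR b * (/ INR c * / INR d).

Lemma inv_gt0 a : (0 < a)%N -> 0 < / INR a.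
Proof. by move=> a0; apply: Rinv_0_lt_compat; apply: lt_0_INR; apply/ltP. Qed.

Lemma wt_bounds a b c d : (0 < a <= N)%N -> (0 < b <= N)%N -> (0 < c <= N)%N ->
  (0 < d <= N)%N -> 0 <= wt a b c d <= ut a b c d.
Proof.
move=> /w_bounds [ha _] /w_bounds [hb _] /w_bounds [hc _] /w_bounds [hd _].
rewrite /wt /ut; split; first by repeat apply: Rmult_le_pos; lra.
have := prod4_diff ha hb hc hd; lra.
Qed.

Lemma sum4_flip (f : nat -> nat -> nat -> nat -> R) :
  sum4 N f = sum4 N (fun a b c d => f b a d c).
Proof. by rewrite sum4_swap12 sum4_swap34. Qed.

(** For fixed a and d the product b c is prescribed, leaving at most D pairs. The arbitrary function
    n covers a d, a d + j p and j p - a d alike. *)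
Lemma sum4_count (n : nat -> nat -> nat) (F : nat -> nat -> R) :
  (forall a d, (0 < a)%N -> (0 < d)%N -> 0 <= F a d) ->
  sum4 N (fun a b c d => ind (n a d == b * c)%N * F a d) <=
  D * \rsum_(1 <= a < N.+1) \rsum_(1 <= d < N.+1) F a d.
Proof.
move=> F0; rewrite sum4_swap34 sum4_swap23 /sum4 -rsum_mull.
apply: rsum_nat_le => a /andP [a0 _]; rewrite -rsum_mull.
apply: rsum_nat_le => d /andP [d0 _].
under eq_bigr => b _ do rewrite rsum_mulr.
by rewrite rsum_mulr; apply: Rmult_le_compat_r; [apply: F0 | apply: count_factorizations].
Qed.

(** On the diagonal each weight defect turns into 8 / p^2 times an inverse square, which is
    summable: D choices, 2 N [zsum 2 N] and two such families give 128/3 D / p. *)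
Lemma exact_error :
  Rabs (sum4 N (fun a b c d => ind (a * d == b * c)%N * wt a b c d) - Gsum N) <= 43 * D / INR p.
Proof.
have p0 : 0 < INR p by apply: lt_0_INR; rewrite pN; lia.
have ip : 0 < / INR p ^ 2 by apply: Rinv_0_lt_compat; apply: pow_lt.
pose q : R := 8 / INR p ^ 2; have q0 : 0 <= q by rewrite /q /Rdiv; lra.
pose f a d := / INR a ^ 2 + / INR d ^ 2.
have f0 a d : (0 < a)%N -> (0 < d)%N -> 0 <= f a d.
  move=> a0 d0; have := inv_gt0 a0; have := inv_gt0 d0; rewrite /f -!pow_inv.
  by move=> h1 h2; have := pow2_ge_0 (/ INR a); have := pow2_ge_0 (/ INR d); lra.
have fsum : \rsum_(1 <= a < N.+1) \rsum_(1 <= d < N.+1) f a d = 2 * INR N * zsum 2 N.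
  rewrite /f; under eq_bigr => a _ do rewrite rsum_add rsum_nat_const subn1 /=.
  by rewrite rsum_add rsum_mull rsum_nat_const subn1 /= -/(zsum 2 N) /zsum; ring.
have low : sum4 N (fun a b c d => ind (a * d == b * c)%N * wt a b c d) <= Gsum N.
  apply: sum4_le => a b c d ha hb hc hd; apply: Rmult_le_compat_l; first exact: ind_ge0.
  by have := wt_bounds ha hb hc hd; rewrite /ut; lra.
have high : Gsum N - sum4 N (fun a b c d => ind (a * d == b * c)%N * wt a b c d) <=
    q * (D * (2 * INR N * zsum 2 N) + D * (2 * INR N * zsum 2 N)).
  apply: (@Rle_trans _ (q * (sum4 N (fun a b c d => ind (a * d == b * c)%N * f a d) +
      sum4 N (fun a b c d => ind (b * c == a * d)%N * f b c)))).
    rewrite -sum4_add -sum4_mull -sum4_sub; apply: sum4_le => a b c d ha hb hc hd.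
    rewrite [(b * c == _)%N]eq_sym; case: eqP => [e|_] /=; last by lra.
    have [ha1 ha2] := w_bounds ha; have [hb1 hb2] := w_bounds hb.
    have [hc1 hc2] := w_bounds hc; have [hd1 hd2] := w_bounds hd.
    have [_] := prod4_diff ha1 hb1 hc1 hd1.
    have a0 : 0 < INR a by apply: lt_0_INR; lia.
    have b0 : 0 < INR b by apply: lt_0_INR; lia.
    have c0 : 0 < INR c by apply: lt_0_INR; lia.
    have d0 : 0 < INR d by apply: lt_0_INR; lia.
    have E : INR a * INR d = INR b * INR c by rewrite -!mult_INR; congr INR.
    have i x : 0 < x -> 0 < / x by apply: Rinv_0_lt_compat.
    (* With x t = y z, a defect 8 x / p^2 multiplied by 1 / (y z t) = 1 / (x t^2) becomes 8 / (p^2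
       t^2): the relation cancels the growth of the defect in x. *)
    have step (x y z t : R) : 0 < x -> 0 < y -> 0 < z -> 0 < t -> x * t = y * z ->
        forall v, / x - v <= 8 * x / INR p ^ 2 ->
        (/ x - v) * (/ y * / z * / t) <= q * / t ^ 2.
      move=> x0 y0 z0 t0 xt v hv.
      have -> : q * / t ^ 2 = 8 * x / INR p ^ 2 * (/ y * / z * / t).
        have -> : / y * / z * / t = / (x * t) * / t by rewrite xt; field; lra.
        by rewrite /q; field; lra.
      apply: Rmult_le_compat_r => //.
      by apply: Rlt_le; repeat apply: Rmult_lt_0_compat; apply: i.
    have s1 := step _ _ _ _ a0 b0 c0 d0 E _ ha2.
    have s2 := step _ _ _ _ b0 a0 d0 c0 (esym E) _ hb2.
    have s3 : (/ INR c - w c) * (/ INR a * / INR d * / INR b) <= q * / INR b ^ 2.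
      by apply: step => //; lra.
    have s4 : (/ INR d - w d) * (/ INR b * / INR c * / INR a) <= q * / INR a ^ 2.
      by apply: step => //; lra.
    rewrite /f /wt; move=> H.
    have r2 : (/ INR b - w b) * (/ INR a * / INR c * / INR d) = (/ INR b - w b) * (/ INR a * / INR d * / INR c) by ring.
    have r3 : (/ INR c - w c) * (/ INR a * / INR b * / INR d) = (/ INR c - w c) * (/ INR a * / INR d * / INR b) by ring.
    have r4 : (/ INR d - w d) * (/ INR a * / INR b * / INR c) = (/ INR d - w d) * (/ INR b * / INR c * / INR a) by ring.
    rewrite r2 r3 r4 in H; lra.
  apply: Rmult_le_compat_l => //; apply: Rplus_le_compat.
    by rewrite -fsum; apply: sum4_count.
  by rewrite sum4_flip -fsum; apply: sum4_count.
have z := zsum2_le N_gt0; have z0 := zsum_ge0 2 N.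
have n2 : 2 * INR N <= INR p by rewrite pN S_INR plus_INR; lra.
have n0 : 0 <= INR N := pos_INR N.
have b1 : 2 * INR N * zsum 2 N <= INR p * (8 / 3) by apply: Rmult_le_compat; lra.
have b2 : D * (2 * INR N * zsum 2 N) <= D * (INR p * (8 / 3)) by apply: Rmult_le_compat_l; lra.
have b3 : q * (D * (2 * INR N * zsum 2 N) + D * (2 * INR N * zsum 2 N)) <=
   q * (D * (INR p * (8 / 3)) + D * (INR p * (8 / 3))) by apply: Rmult_le_compat_l; lra.
have b4 : q * (D * (INR p * (8 / 3)) + D * (INR p * (8 / 3))) = 128 / 3 * D / INR p.
  by rewrite /q; field; lra.
have b5 : 128 / 3 * D / INR p <= 43 * D / INR p.
  by apply: Rmult_le_compat_r; [apply: Rlt_le; apply: Rinv_0_lt_compat | lra].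
by apply: Rabs_le; lra.
Qed.

Lemma harm_square :
  \rsum_(1 <= a < N.+1) \rsum_(1 <= d < N.+1) (/ INR a * / INR d) = harm N ^ 2.
Proof. by rewrite /= Rmult_1_r {2}/harm -rsum_mulr; apply: eq_bigr => a _; rewrite rsum_mull. Qed.

(** The off-diagonal solutions of a d = +- b c mod p, sorted by the multiple j p, j >= 1, that
    separates or sums the two products. *)
Definition near_miss (a b c d j : nat) : R :=
  ind (a * d == b * c + j * p)%N + ind (b * c == a * d + j * p)%N + ind (a * d + b * c == j * p)%N.

(** If one product exceeds the other by j p, its reciprocal is at most 1 / (j p); the smaller pair
    is summed freely, giving [harm N ^ 2], and the larger one has at most D factorizations. The two
    differences cost one unit each and the sum, after partial fractions, two: hence 4. *)
Lemma near_miss_sum j : (0 < j)%N ->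
  sum4 N (fun a b c d => near_miss a b c d j * ut a b c d) <=
  4 * D * harm N ^ 2 / INR p * / INR j.
Proof.
move=> j0; have p0 : 0 < INR p by apply: lt_0_INR; rewrite pN; lia.
have j1 := INR_ge1 j0.
pose s : R := / (INR j * INR p); have s0 : 0 < s by apply: Rinv_0_lt_compat; nra.
pose F a d := s * (/ INR a * / INR d).
have F0 a d : (0 < a)%N -> (0 < d)%N -> 0 <= F a d.
  by move=> /inv_gt0 ? /inv_gt0 ?; apply: Rmult_le_pos; [lra | apply: Rmult_le_pos; lra].
have Fsum : \rsum_(1 <= a < N.+1) \rsum_(1 <= d < N.+1) F a d = s * harm N ^ 2.
  by rewrite -harm_square -rsum_mull; apply: eq_bigr => a _; rewrite -rsum_mull.
have cnt n : sum4 N (fun a b c d => ind (n a d == b * c)%N * F a d) <= D * (s * harm N ^ 2).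
  by rewrite -Fsum; apply: sum4_count.
have cnt' n : sum4 N (fun a b c d => ind (n b c == a * d)%N * F b c) <= D * (s * harm N ^ 2).
  by rewrite sum4_flip; apply: cnt.
have -> : 4 * D * harm N ^ 2 / INR p * / INR j = 4 * (D * (s * harm N ^ 2)).
  by rewrite /s; field; lra.
apply: (@Rle_trans _ (
  (sum4 N (fun a b c d => ind (b * c + j * p == a * d)%N * F b c) +
   sum4 N (fun a b c d => ind (a * d + j * p == b * c)%N * F a d)) +
  (sum4 N (fun a b c d => ind (j * p - a * d == b * c)%N * F a d) +
   sum4 N (fun a b c d => ind (j * p - b * c == a * d)%N * F b c)))); last first.
  have := cnt (fun a d => a * d + j * p)%N; have := cnt' (fun a d => a * d + j * p)%N.
  have := cnt (fun a d => j * p - a * d)%N; have := cnt' (fun a d => j * p - a * d)%N.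
  by rewrite /=; lra.
rewrite -!sum4_add; apply: sum4_le => a b c d /andP [a0 _] /andP [b0 _] /andP [c0 _] /andP [d0 _].
have F0ad := F0 _ _ a0 d0; have F0bc := F0 _ _ b0 c0.
have a1 := INR_ge1 a0; have b1 := INR_ge1 b0; have c1 := INR_ge1 c0; have d1 := INR_ge1 d0.
have le_jp (x y z t : R) : 1 <= x -> 1 <= y -> 1 <= z -> 1 <= t -> x * t = y * z + INR j * INR p ->
    / x * / t * (/ y * / z) <= s * (/ y * / z).
  move=> x1 y1 z1 t1 e; apply: Rmult_le_compat_r.
    by apply: Rlt_le; apply: Rmult_lt_0_compat; apply: Rinv_0_lt_compat; lra.
  rewrite -Rinv_mult /s; apply: Rinv_le_contravar; first by nra.
  by rewrite e; nra.
have ut_ge0 : 0 <= ut a b c d.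
  by rewrite /ut; repeat apply: Rmult_le_pos; apply: Rlt_le; apply: inv_gt0.
have utE : ut a b c d = / INR a * / INR d * (/ INR b * / INR c) by rewrite /ut; ring.
have t1 : ind (a * d == b * c + j * p)%N * ut a b c d <= ind (b * c + j * p == a * d)%N * F b c.
  rewrite eq_sym; case: eqP => [e|_] /=; last by lra.
  rewrite !Rmult_1_l utE; apply: le_jp => //.
  by rewrite -!mult_INR -plus_INR; congr INR.
have t2 : ind (b * c == a * d + j * p)%N * ut a b c d <= ind (a * d + j * p == b * c)%N * F a d.
  rewrite eq_sym; case: eqP => [e|_] /=; last by lra.
  rewrite !Rmult_1_l utE Rmult_comm; apply: le_jp => //.
  by rewrite -!mult_INR -plus_INR; congr INR.
(* 1 / (x y) = (1 / x + 1 / y) / (x + y) with x = ad, y = bc. *)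
have t3 : ind (a * d + b * c == j * p)%N * ut a b c d <=
    ind (j * p - a * d == b * c)%N * F a d + ind (j * p - b * c == a * d)%N * F b c.
  case: eqP => [e|_]; last first.
    have := ind_ge0 (j * p - a * d == b * c)%N; have := ind_ge0 (j * p - b * c == a * d)%N.
    by rewrite /=; nra.
  have ejp : INR j * INR p = INR a * INR d + INR b * INR c.
    by rewrite -!mult_INR -plus_INR; congr INR.
  rewrite -e addKn addnK !eqxx /= !Rmult_1_l utE /F /s ejp.
  by apply: Req_le; field; nra.
by rewrite /near_miss !Rmult_plus_distr_r; lra.
Qed.

Lemma ind_le_rsum (P : nat -> bool) j0 m : (0 < j0 < m)%N -> P j0 ->
  1 <= \rsum_(1 <= j < m) ind (P j).
Proof.
move=> /andP [j1 j2] Pj; rewrite (@big_cat_nat _ _ _ j0) ?(ltnW j2) //= (@big_ltn _ _ _ j0) // Pj /=.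
have ge0 u v : 0 <= \rsum_(u <= j < v) ind (P j) by apply: rsum_ge0 => j _; apply: ind_ge0.
by have := ge0 1%N j0; have := ge0 j0.+1 m; lra.
Qed.

(** Both products lie below p N, so their difference and sum lie below p^2 and j <= p suffices. *)
Lemma near_miss_cover a b c d : (0 < a <= N)%N -> (0 < b <= N)%N -> (0 < c <= N)%N ->
  (0 < d <= N)%N ->
  Rabs (ind (a * d == b * c %[mod p])%N - ind (p %| a * d + b * c)%N - ind (a * d == b * c)%N)
  <= \rsum_(1 <= j < p.+1) near_miss a b c d j.
Proof.
move=> /andP [a0 aN] /andP [b0 bN] /andP [c0 cN] /andP [d0 dN].
have p1 : (0 < p)%N by rewrite pN.
have ad : (a * d < p * N)%N by rewrite pN; nia.
have bc : (b * c < p * N)%N by rewrite pN; nia.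
have NP : (p * N <= p * p)%N by rewrite leq_mul2l pN; lia.
rewrite /near_miss !rsum_add.
set s1 := \rsum_(_ <= _ < _) _; set s2 := \rsum_(_ <= _ < _) _; set s3 := \rsum_(_ <= _ < _) _.
have pos (P : nat -> bool) : 0 <= \rsum_(1 <= j < p.+1) ind (P j).
  by apply: rsum_ge0 => j _; apply: ind_ge0.
have s1_0 : 0 <= s1 by apply: pos.
have s2_0 : 0 <= s2 by apply: pos.
have s3_0 : 0 <= s3 by apply: pos.
have h3 : 0 <= ind (p %| a * d + b * c)%N <= s3.
  split; first exact: ind_ge0.
  case: dvdnP => [[j e]|_] //=; apply: (@ind_le_rsum _ j); last by apply/eqP.
  by nia.
have h12 : 0 <= ind (a * d == b * c %[mod p])%N - ind (a * d == b * c)%N <= s1 + s2.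
  case: (ltngtP (a * d) (b * c)) => [lt|gt|->]; last by rewrite eqxx /=; lra.
  - rewrite [ind false]/= Rminus_0_r; split; first exact: ind_ge0.
    case: eqP => [e|_] /=; last by lra.
    suff : 1 <= s2 by lra.
    have dv : (p %| b * c - a * d)%N by rewrite -eqn_mod_dvd ?(ltnW lt) // e.
    apply: (@ind_le_rsum _ ((b * c - a * d) %/ p)%N).
      by rewrite divn_gt0 // dvdn_leq ?subn_gt0 //= ltnS; apply: leq_trans (leq_div2r _ (leq_subr _ _)) _; apply: ltnW; rewrite ltn_divLR //; apply: leq_trans bc NP.
    by rewrite divnK // subnKC // ltnW.
  - rewrite [ind false]/= Rminus_0_r; split; first exact: ind_ge0.
    case: eqP => [e|_] /=; last by lra.
    suff : 1 <= s1 by lra.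
    have dv : (p %| a * d - b * c)%N by rewrite -eqn_mod_dvd ?(ltnW gt) // e.
    apply: (@ind_le_rsum _ ((a * d - b * c) %/ p)%N).
      by rewrite divn_gt0 // dvdn_leq ?subn_gt0 //= ltnS; apply: leq_trans (leq_div2r _ (leq_subr _ _)) _; apply: ltnW; rewrite ltn_divLR //; apply: leq_trans ad NP.
    by rewrite divnK // subnKC // ltnW.
by apply: Rabs_le; lra.
Qed.
End ErrorTerms.

(** * The mean square of Dedekind sums and the divisor bound *)

Section SquareSum.
Variable p : nat.
Hypothesis p_pr : prime p.
Hypothesis p_gt3 : (3 < p)%N.
Variable D : R.
Hypothesis D_ge1 : 1 <= D.
Hypothesis count_factorizations : forall n,
  \rsum_(1 <= b < p./2.+1) \rsum_(1 <= c < p./2.+1) ind (n == b * c)%N <= D.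

Lemma harm_mono M N : (M <= N)%N -> harm M <= harm N.
Proof.
move=> MN; rewrite /harm [X in _ <= X](@big_cat_nat _ _ _ M.+1) //=.
set s := (X in _ <= _ + X).
suff : 0 <= s by lra.
rewrite /s big_nat; apply: rsum_ge0 => n /andP [n0 _].
by apply: Rlt_le; apply: Rinv_0_lt_compat; apply: lt_0_INR; lia.
Qed.

(** In units of D [harm p ^ 3] / p the errors are 4 for near misses, whose third harmonic factor is
    the sum over j, 43 for the weights, and 360 for the main term, as p <= 3 N. Since pi >= 3, the
    prefactor p^2 / (2 pi^4) turns 407 into 407 / 162 < 3. *)
Lemma dedekind_square_rate :
  Rabs (\rsum_(h : 'F_p) dedF h ^ 2 - 5 / 144 * INR p ^ 2) <= 3 * INR p * (D * harm p ^ 3).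
Proof.
set N := p./2.
have pN : p = (N + N).+1 := p_half p_pr p_gt3.
have N_gt0 : (0 < N)%N by move: p_gt3; rewrite pN; lia.
have p0 : 0 < INR p by apply: lt_0_INR; lia.
have pi3 : 3 <= PI by have := PI2_3_2; lra.
have pi4 : 81 <= PI ^ 4.
  by rewrite (_ : 81 = 3 ^ 4); [apply: pow_incr; lra | ring].
rewrite dedF_square_sum // -/N.
pose w := @cw p.
have wb a : (0 < a <= N)%N -> 0 <= w a <= / INR a /\ / INR a - w a <= 8 * INR a / INR p ^ 2.
  by move=> aN; apply: cw_bounds.
pose f a b c d := ind (a * d == b * c %[mod p])%N - ind (p %| a * d + b * c)%N.
pose wt a b c d := w a * w b * (w c * w d).
set S := \rsum_(1 <= a < N.+1) _.
have SE : S = sum4 N (fun a b c d => f a b c d * wt a b c d).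
  by apply: eq_sum4 => a b c d *; rewrite /f /wt /w; ring.
have h1 : Rabs (S - sum4 N (fun a b c d => ind (a * d == b * c)%N * wt a b c d)) <=
    4 * D * harm N ^ 2 / INR p * harm p.
  pose T := sum4 N (fun a b c d => (\rsum_(1 <= j < p.+1) near_miss p a b c d j) *
    (/ INR a * / INR b * (/ INR c * / INR d))).
  apply: (@Rle_trans _ T); last first.
    rewrite /T.
    rewrite (_ : sum4 N _ = \rsum_(1 <= j < p.+1) sum4 N (fun a b c d => near_miss p a b c d j *
       (/ INR a * / INR b * (/ INR c * / INR d)))); last first.
      by rewrite -sum4_big; apply: eq_sum4 => a b c d *; rewrite rsum_mulr.
    rewrite /harm -rsum_mull big_nat [X in _ <= X]big_nat; apply: rsum_le => j /andP [j0 _].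
    exact: (near_miss_sum pN N_gt0 count_factorizations j0).
  have key a b c d : (0 < a <= N)%N -> (0 < b <= N)%N -> (0 < c <= N)%N -> (0 < d <= N)%N ->
     Rabs (f a b c d * wt a b c d - ind (a * d == b * c)%N * wt a b c d) <=
     (\rsum_(1 <= j < p.+1) near_miss p a b c d j) * (/ INR a * / INR b * (/ INR c * / INR d)).
    move=> ha hb hc hd; have wu := wt_bounds wb ha hb hc hd.
    rewrite -Rmult_minus_distr_r Rabs_mult (Rabs_pos_eq (wt _ _ _ _)); last exact: (proj1 wu).
    apply: Rmult_le_compat; [exact: Rabs_pos | exact: (proj1 wu) | | exact: (proj2 wu)].
    exact: (near_miss_cover pN N_gt0).
  rewrite SE -sum4_sub; apply: Rabs_le; split.
    rewrite -[- T]Rmult_1_l -Ropp_mult_distr_r Ropp_mult_distr_l /T -sum4_mull.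
    apply: sum4_le => a b c d ha hb hc hd.
    by have /Rabs_le_between k := key _ _ _ _ ha hb hc hd; lra.
  apply: sum4_le => a b c d ha hb hc hd.
  by have /Rabs_le_between k := key _ _ _ _ ha hb hc hd; lra.
have h2 := exact_error pN N_gt0 D_ge1 count_factorizations wb.
have h3 := Gsum_rate N_gt0.
have H1 := harm_ge1 N_gt0.
have H2 : harm N <= harm p by apply: harm_mono; rewrite pN; lia.
have N1 := INR_ge1 N_gt0.
have pN3 : INR p <= 3 * INR N by rewrite pN S_INR plus_INR; lra.
pose Q := D * harm p ^ 3 / INR p.
have ip : 0 < / INR p by apply: Rinv_0_lt_compat.
have c3 : harm p <= harm p ^ 3 by have := Rle_pow (harm p) 1 3 ltac:(lra) ltac:(lia); lra.
have c3' : 1 <= harm p ^ 3 by lra.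
have D3 : harm p ^ 3 <= D * harm p ^ 3 by nra.
have q1 : 4 * D * harm N ^ 2 / INR p * harm p <= 4 * Q.
  have -> : 4 * Q = 4 * D * harm p ^ 2 / INR p * harm p by rewrite /Q; field; lra.
  apply: Rmult_le_compat_r; first by lra.
  apply: Rmult_le_compat_r; first by lra.
  apply: Rmult_le_compat_l; first by lra.
  by apply: pow_incr; lra.
have q2 : 43 * D / INR p <= 43 * Q.
  have -> : 43 * Q = 43 * (D * harm p ^ 3) / INR p by rewrite /Q; field; lra.
  by apply: Rmult_le_compat_r; first lra; nra.
have q3 : 120 * harm N / INR N <= 360 * Q.
  apply: (@Rle_trans _ (360 * harm p / INR p)); last first.
    have -> : 360 * Q = 360 * (D * harm p ^ 3) / INR p by rewrite /Q; field; lra.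
    by apply: Rmult_le_compat_r; lra.
  apply: (Rmult_le_reg_r (INR N * INR p)); first by nra.
  have -> : 120 * harm N / INR N * (INR N * INR p) = 120 * (harm N * INR p) by field; lra.
  have -> : 360 * harm p / INR p * (INR N * INR p) = 120 * (harm p * (3 * INR N)) by field; lra.
  by apply: Rmult_le_compat_l; [lra | apply: Rmult_le_compat; lra].
move/Rabs_le_between: h1 => h1; move/Rabs_le_between: h2 => h2; move/Rabs_le_between: h3 => h3.
have tot : Rabs (S - 5 * PI ^ 4 / 72) <= 407 * Q.
  rewrite /wt in h1 h2; apply: Rabs_le; lra.
have -> : INR p ^ 2 / (2 * PI ^ 4) * S - 5 / 144 * INR p ^ 2 =
  INR p ^ 2 / (2 * PI ^ 4) * (S - 5 * PI ^ 4 / 72) by field; lra.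
have k0 : 0 <= INR p ^ 2 / (2 * PI ^ 4).
  by apply: Rmult_le_pos; [apply: pow2_ge_0 | apply: Rlt_le; apply: Rinv_0_lt_compat; lra].
have k1 : INR p ^ 2 / (2 * PI ^ 4) <= INR p ^ 2 / 162.
  by apply: Rmult_le_compat_l; [apply: pow2_ge_0 | apply: Rinv_le_contravar; lra].
rewrite Rabs_mult Rabs_pos_eq //.
apply: (@Rle_trans _ (INR p ^ 2 / 162 * (407 * Q))).
  by apply: Rmult_le_compat => //; apply: Rabs_pos.
have -> : INR p ^ 2 / 162 * (407 * Q) = 407 / 162 * (INR p * (D * harm p ^ 3)).
  by rewrite /Q; field; lra.
have : 0 <= INR p * (D * harm p ^ 3) by apply: Rmult_le_pos; lra.
lra.
Qed.
End SquareSum.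

(** * An upper bound for the divisor function *)

Notation dv n := (size (divisors n)).

(** A divisor of q^(e+1) m either divides q^e m or is q^(e+1) times a divisor of m. *)
Lemma dv_prime_step (q e m : nat) : prime q -> (0 < m)%N -> coprime q m ->
  (dv (q ^ e.+1 * m) <= dv (q ^ e * m) + dv m)%N.
Proof.
move=> q_pr m0 cqm; have q0 := prime_gt0 q_pr.
rewrite -(size_map (muln (q ^ e.+1)) (divisors m)) -size_cat.
apply: uniq_leq_size; first exact: divisors_uniq.
move=> a; rewrite mem_cat -!dvdn_divisors ?muln_gt0 ?expn_gt0 ?q0 // => adv.
have a0 : (0 < a)%N by apply: dvdn_gt0 adv; rewrite muln_gt0 expn_gt0 q0.
case: (boolP (q ^ e.+1 %| a)) => [/dvdnP [a' aE]|nd]; apply/orP; [right|left].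
  apply/mapP; exists a'; last by rewrite aE mulnC.
  by rewrite -dvdn_divisors // -(@dvdn_pmul2l (q ^ e.+1)) ?expn_gt0 ?q0 // mulnC -aE.
have [a' ca aE] := pfactor_coprime q_pr a0.
have le : (logn q a <= e)%N by rewrite leqNgt -pfactor_dvdn.
rewrite aE mulnC; apply: dvdn_mul; first exact: dvdn_exp2l.
have : (a' %| q ^ e.+1 * m)%N by apply: dvdn_trans adv; rewrite aE dvdn_mulr.
by rewrite Gauss_dvdr // coprime_sym coprimeXl.
Qed.

Lemma dv_dvdn m n : (0 < n)%N -> (m %| n)%N -> (dv m <= dv n)%N.
Proof.
move=> n0 mn; have m0 := dvdn_gt0 n0 mn.
apply: uniq_leq_size; first exact: divisors_uniq.
by move=> a; rewrite -!dvdn_divisors // => am; apply: dvdn_trans mn.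
Qed.

Lemma dv_prime_power (q e m : nat) : prime q -> (0 < m)%N -> coprime q m ->
  (dv (q ^ e * m) <= e.+1 * dv m)%N.
Proof.
move=> q_pr m0 cqm; elim: e => [|e IH]; first by rewrite mul1n mul1n.
by apply: leq_trans (dv_prime_step e q_pr m0 cqm) _; rewrite mulSn addnC leq_add2l.
Qed.

Lemma dv_prime_mul (q n : nat) : prime q -> (0 < n)%N -> (dv (q * n) <= 2 * dv n)%N.
Proof.
move=> q_pr n0; have [m cqm nE] := pfactor_coprime q_pr n0.
have m0 : (0 < m)%N by move: n0; rewrite nE muln_gt0 => /andP [].
have := dv_prime_step (logn q n) q_pr m0 cqm.
rewrite expnS -mulnA [(_ ^ _ * m)%N]mulnC -nE => h; apply: leq_trans h _.
by rewrite mul2n -addnn leq_add2l dv_dvdn // nE dvdn_mulr.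
Qed.

(** Here j is the number of prime factors with multiplicity: each one at most doubles the divisor
    count and multiplies n by at least B. *)
Lemma dv_large_primes (B n : nat) : (0 < n)%N ->
  (forall q, prime q -> (q %| n)%N -> (B <= q)%N) ->
  exists j, (B ^ j <= n)%N /\ (dv n <= 2 ^ j)%N.
Proof.
elim/ltn_ind: n => n IH n0 big.
have [->|n1] := eqVneq n 1%N; first by exists 0%N.
have n2 : (1 < n)%N by rewrite ltn_neqAle eq_sym n1.
have q_pr := pdiv_prime n2; have qn := pdiv_dvd n.
set q := pdiv n in q_pr qn.
have [m nE] := dvdnP qn; rewrite mulnC in nE.
have m0 : (0 < m)%N by move: n0; rewrite nE muln_gt0 => /andP [].
have [j [h1 h2]] : exists j, (B ^ j <= m)%N /\ (dv m <= 2 ^ j)%N.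
  apply: IH => //; first by rewrite nE ltn_Pmull // prime_gt1.
  by move=> r r_pr rm; apply: big => //; rewrite nE dvdn_mull.
exists j.+1; split; first by rewrite nE expnS leq_mul // big.
by rewrite nE; apply: leq_trans (dv_prime_mul q_pr m0) _; rewrite expnS leq_mul2l.
Qed.

(* Primes up to B contribute a factor at most K each, the others at most 2^j with B^j <= n. *)
Lemma dv_bound (B K n : nat) : (0 < n)%N -> (n < 2 ^ K)%N ->
  exists j, (B ^ j <= n)%N /\ (dv n <= K ^ B * 2 ^ j)%N.
Proof.
move=> n0 nK.
(* Induction on the width k of the window (B - k, B] of small primes allowed; each step strips the
   full power of q = B - k when q is a prime factor. *)
suff H k : (k <= B)%N -> forall n, (0 < n)%N -> (n < 2 ^ K)%N ->
    (forall q, prime q -> (q %| n)%N -> (B - k < q)%N) ->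
    exists j, (B ^ j <= n)%N /\ (dv n <= K ^ k * 2 ^ j)%N.
  by apply: (H B) => // q q_pr _; rewrite subnn prime_gt0.
elim: k {n n0 nK} => [|k IH] kB n n0 nK big.
  have [|j [h1 h2]] := @dv_large_primes B n n0.
    by move=> q q_pr qn; apply: ltnW; have := big q q_pr qn; rewrite subn0.
  by exists j; rewrite expn0 mul1n.
have K0 : (0 < K)%N by case: K nK {IH} => //; rewrite expn0; lia.
set q := (B - k)%N.
have cases r : prime r -> (r %| n)%N -> r != q -> (q < r)%N.
  by move=> r_pr rn rq; have := big r r_pr rn; rewrite /q; move: rq; rewrite /q; lia.
have weaken (m j : nat) : (m <= K ^ k * 2 ^ j)%N -> (m <= K ^ k.+1 * 2 ^ j)%N.
  by move/leq_trans; apply; rewrite leq_mul2r leq_pexp2l ?orbT.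
case: (boolP (prime q && (q %| n)%N)) => [/andP [q_pr qn]|nq]; last first.
  have [|j [h1 h2]] := IH (ltnW kB) n n0 nK.
    move=> r r_pr rn; apply: cases => //; apply: contraNneq nq => <-.
    by rewrite r_pr rn.
  by exists j; split=> //; apply: weaken.
have [m cqm nE] := pfactor_coprime q_pr n0.
have m0 : (0 < m)%N by move: n0; rewrite nE muln_gt0 => /andP [].
have mn : (m <= n)%N by rewrite nE leq_pmulr // expn_gt0 prime_gt0.
have [|j [h1 h2]] := IH (ltnW kB) m m0 (leq_ltn_trans mn nK).
  move=> r r_pr rm; apply: cases => //; first by rewrite nE dvdn_mulr.
  apply: contraTneq cqm => rq; rewrite -rq prime_coprime // negbK //.
exists j; split; first exact: leq_trans mn.
(* 2^e <= q^e <= n < 2^K for the exponent e of q, so e + 1 <= K bounds the factor from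
   [dv_prime_power]. *)
have eK : (logn q n < K)%N.
  rewrite -(@ltn_exp2l 2) //; apply: leq_ltn_trans nK.
  apply: (@leq_trans (q ^ logn q n)); first by case: (logn q n) => // e; rewrite leq_exp2r // prime_gt1.
  by rewrite dvdn_leq // pfactor_dvdnn.
rewrite nE mulnC; apply: leq_trans (dv_prime_power _ q_pr m0 cqm) _.
by rewrite expnS -mulnA leq_mul.
Qed.

(** * Growth of the divisor bound *)

(** Each divisor b of n leaves at most one c, and an n outside [1, N^2] has no factorization of this
    shape. *)
Lemma count_factorizations_le (N n : nat) (D : R) : 0 <= D ->
  (forall k, (0 < k <= N * N)%N -> INR (dv k) <= D) ->
  \rsum_(1 <= b < N.+1) \rsum_(1 <= c < N.+1) ind (n == b * c)%N <= D.
Proof.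
move=> D0 HD; case: (boolP (0 < n <= N * N)%N) => [nN|nN]; last first.
  rewrite big_nat rsum0 // => b /andP [b1 b2]; rewrite big_nat rsum0 // => c /andP [c1 c2].
  case: eqP => // nE; case/negP: nN; rewrite nE muln_gt0 b1 c1 /=.
  by apply: leq_mul.
apply: Rle_trans (HD n nN); case/andP: nN => n0 _.
apply: (@Rle_trans _ (\rsum_(1 <= b < N.+1) ind (b %| n)%N)).
  apply: rsum_nat_le => b /andP [b1 _].
  case: (boolP (b %| n)%N) => [/dvdnP [k kE]|nb]; last first.
    apply: Req_le; apply: rsum0 => c _; case: eqP => // nE.
    by case/negP: nb; rewrite nE dvdn_mulr.
  have k0 : (0 < k)%N by move: n0; rewrite kE muln_gt0 => /andP [].
  rewrite (_ : \rsum_(1 <= c < N.+1) _ = \rsum_(1 <= c < N.+1) (ind (c == k) * 1)).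
    by rewrite rsum_delta_nat // Rmult_1_r; apply: ind_le1.
  apply: eq_bigr => c _; rewrite Rmult_1_r; congr ind.
  by rewrite kE mulnC eqn_pmul2l // eq_sym.
rewrite (_ : \rsum_(1 <= b < N.+1) _ = INR (count (fun b => b %| n)%N (index_iota 1 N.+1))).
  apply: le_INR; apply/leP; rewrite -size_filter; apply: uniq_leq_size.
    by rewrite filter_uniq // iota_uniq.
  by move=> b; rewrite mem_filter -dvdn_divisors // => /andP [].
elim: (index_iota 1 N.+1) => [|b s IH]; first by rewrite big_nil.
by rewrite big_cons IH /= plus_INR; case: (b %| n)%N.
Qed.

(** * Logarithmic and exponential inequalities *)

Lemma ln_le_sub1 x : 0 < x -> ln x <= x - 1.
Proof. by move=> x0; have := exp_ineq1_le (ln x); rewrite exp_ln //; lra. Qed.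

Lemma harm_le_ln n : (0 < n)%N -> harm n <= 1 + ln (INR n).
Proof.
case: n => // n _; elim: n => [|n IH]; first by rewrite /harm big_nat1 /= ln_1 Rinv_1; lra.
have rec : harm n.+2 = harm n.+1 + / INR n.+2 by rewrite /harm big_nat_recr.
have n0 : 1 <= INR n.+1 := INR_ge1 (ltn0Sn n).
have n1 : INR n.+2 = INR n.+1 + 1 := S_INR _.
have r0 : 0 < INR n.+1 / INR n.+2 by apply: Rdiv_lt_0_compat; lra.
have := ln_le_sub1 r0; rewrite ln_div; [|lra|lra].
have -> : INR n.+1 / INR n.+2 - 1 = - / INR n.+2 by rewrite n1; field; lra.
by rewrite rec; lra.
Qed.

Lemma exp_le x y : x <= y -> exp x <= exp y.
Proof. by case=> [/exp_increasing|->]; lra. Qed.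

Lemma exp_pow_nat x n : exp x ^ n = exp (INR n * x).
Proof.
elim: n => [|n IH]; first by rewrite /= Rmult_0_l exp_0.
by rewrite S_INR /= IH -exp_plus; congr exp; ring.
Qed.

Lemma exp_lower x n : (0 < n)%N -> 0 <= x -> (1 + x / INR n) ^ n <= exp x.
Proof.
move=> n0 x0; have n1 := INR_ge1 n0.
have -> : exp x = exp (x / INR n) ^ n by rewrite exp_pow_nat; congr exp; field; lra.
apply: pow_incr; split; last exact: exp_ineq1_le.
by have : 0 <= x / INR n by [apply: Rmult_le_pos => //; apply: Rlt_le; apply: Rinv_0_lt_compat; lra]; lra.
Qed.

(** Since 1.045^16 > 2. The value matters because 4 * 0.72 = 2.88 stays below the target 3. *)
Lemma ln2_le : ln 2 <= 72 / 100.
Proof.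
rewrite -(ln_exp (72 / 100)); apply: ln_le; first by lra.
apply: Rle_trans (@exp_lower _ 16 isT _); last by lra.
by rewrite /=; lra.
Qed.

(** Here y = ln ln p. On the left, the first term pays for the small primes and the second for (1 +
    ln p)^3; on the right, 12/100 is the gap between 2.88 and 3. *)
Lemma growth_comparison : exists C, forall y, 0 < y ->
  3 * exp (y / 2) * (y + 4) + 3 * (y + 1) <= 12 / 100 * (exp y / y) + C.
Proof.
(* The left side at y = 700 bounds it on y <= 700; beyond that no constant is used. *)
exists (3 * exp 350 * 704 + 3 * 701) => y y0.
have e0 : 0 < exp y / y by apply: Rdiv_lt_0_compat => //; apply: exp_pos.
have [ys|yl] := Rle_dec y 700.
  have : exp (y / 2) <= exp 350 by apply: exp_le; lra.
  have := exp_pos (y / 2) => h1 h2.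
  have : exp (y / 2) * (y + 4) <= exp 350 * 704 by apply: Rmult_le_compat; lra.
  by lra.
have c0 : 0 < exp 350 := exp_pos _.
set t := exp (y / 2).
have tt : exp y = t * t by rewrite /t -exp_plus; congr exp; field.
(* A quartic lower bound for t beats the quadratic requirement 7 y^2 <= 0.12 t, because (y / 8)^4 >=
   119 y^2 once y > 700. *)
have t1 : (1 + y / 2 / INR 4) ^ 4 <= t by apply: exp_lower => //; lra.
have t2 : (y / 8) ^ 4 <= t.
  by apply: Rle_trans t1; apply: pow_incr; rewrite /=; split; lra.
have t3 : 1 + y / 2 <= t by apply: exp_ineq1_le.
suff : 3 * t * (y + 4) + 3 * (y + 1) <= 12 / 100 * (exp y / y) by lra.
apply: (@Rle_trans _ (7 * y * t)); first by nra.
apply: (Rmult_le_reg_r y) => //.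
have -> : 12 / 100 * (exp y / y) * y = 12 / 100 * exp y by field; lra.
rewrite tt; have y4 : (y / 8) ^ 4 = y ^ 2 * (y ^ 2 / 4096) by field.
have y2 : 490000 <= y ^ 2 by nra.
have : y ^ 2 * (490000 / 4096) <= t.
  by apply: Rle_trans t2; rewrite y4; apply: Rmult_le_compat_l; lra.
by move=> h; have tp : 0 < t := exp_pos _; nra.
Qed.

Lemma divisor_growth : exists C, 0 < C /\ forall p, (7 <= p)%N ->
  exists D, 1 <= D /\ (forall n, (0 < n < p * p)%N -> INR (dv n) <= D) /\
    D * (1 + ln (INR p)) ^ 3 <= C * exp (3 * ln (INR p) / ln (ln (INR p))).
Proof.
have [C0 HC0] := growth_comparison; exists (exp C0); split; first exact: exp_pos.
move=> p p7; set L := ln (INR p).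
have P7 : 7 <= INR p by rewrite (_ : 7%Re = INR 7); [apply: le_INR; apply/leP | rewrite /=; lra].
have L1 : 1 < L.
  rewrite /L -(ln_exp 1); apply: ln_increasing; first exact: exp_pos.
  by have := exp_le_3; lra.
set y := ln L; have y0 : 0 < y by rewrite /y -ln_1; apply: ln_increasing; lra.
have Ly : exp y = L by apply: exp_ln; lra.
pose t := exp (y / 2); have tt : t * t = L by rewrite /t -exp_plus -Ly; congr exp; field.
have t1 : 1 <= t by have := exp_ineq1_le (y / 2); rewrite -/t; lra.
exists (exp (3 * t * (y + 4) + 288 / 100 * (L / y))).
have Ly0 : 0 < L / y by apply: Rdiv_lt_0_compat; lra.
have e0 : 0 <= 3 * t * (y + 4) by apply: Rmult_le_pos; lra.
split; first by have := exp_ineq1_le (3 * t * (y + 4) + 288 / 100 * (L / y)); lra.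
split; last first.
  have h1 : (1 + L) ^ 3 <= exp (3 * (y + 1)).
    rewrite (_ : 3 * (y + 1) = INR 3 * (y + 1)); last by rewrite /=; lra.
    rewrite -exp_pow_nat; apply: pow_incr; split; first by lra.
    rewrite exp_plus Ly; have := exp_ineq1_le 1; nra.
  apply: (@Rle_trans _ (exp (3 * t * (y + 4) + 288 / 100 * (L / y)) * exp (3 * (y + 1)))).
    by apply: Rmult_le_compat_l => //; apply: Rlt_le; apply: exp_pos.
  rewrite -!exp_plus; apply: exp_le.
  by have := HC0 y y0; rewrite -/t Ly (_ : 3 * L / y = 3 * (L / y)); [lra | field; lra].
(* Parameters for [dv_bound]: B is of size sqrt(ln p), so that ln B >= y / 2 while B ln K stays
   negligible against ln p / y. K exceeds 4 ln p, and 2^K > p^2 then follows from ln 2 > 1/2. *)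
have [B0 hB] := nfloor_ex t (Rle_trans _ _ _ Rle_0_1 t1).
have L4 : 0 <= 4 * L by lra.
have [K0 hK] := nfloor_ex _ L4.
pose B := B0.+2; pose K := K0.+1.
have Bt : t <= INR B <= 3 * t by rewrite /B 2!S_INR; lra.
have K4 : 4 * L < INR K <= 5 * L by rewrite /K S_INR; lra.
move=> n /andP [n0 np].
have N1 := INR_ge1 n0.
have pp : exp (2 * L) = INR p * INR p.
  by rewrite (_ : 2 * L = L + L) ?exp_plus ?exp_ln; lra.
have np' : INR n < exp (2 * L) by rewrite pp -mult_INR; apply: lt_INR; apply/ltP.
have ln2 := ln_lt_2; have ln2' := ln2_le.
have expn_exp a k : (0 < a)%N -> INR (a ^ k)%N = exp (INR k * ln (INR a)).
  move=> a0; have a1 := INR_ge1 a0; rewrite -exp_pow_nat exp_ln; last by lra.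
  by elim: k => [|k IH] //=; rewrite expnS mult_INR IH.
have nK : (n < 2 ^ K)%N.
  apply/ltP; apply: INR_lt; apply: Rlt_trans np' _.
  rewrite expn_exp // (_ : INR 2 = 2) //; apply: exp_increasing.
  by nra.
have [j [h1 h2]] := dv_bound B n0 nK.
have j1 : INR j * ln (INR B) < 2 * L.
  apply: exp_lt_inv; rewrite -expn_exp //; apply: Rle_lt_trans np'.
  by apply: le_INR; apply/leP.
have lnB : y / 2 <= ln (INR B).
  by rewrite -(ln_exp (y / 2)); apply: ln_le; [apply: exp_pos | rewrite -/t; lra].
(* B^j <= n < p^2 gives j <= 2 L / (y / 2) = 4 L / y, and ln 2 <= 0.72 gives 2.88. *)
have j2 : INR j * ln 2 <= 288 / 100 * (L / y).
  have j0 := pos_INR j.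
  have : INR j <= 4 * (L / y).
    apply: (Rmult_le_reg_r y) => //.
    have -> : 4 * (L / y) * y = 4 * L by field; lra.
    by nra.
  by nra.
have lnK : 0 <= ln (INR K) <= y + 4.
  split; first by rewrite -ln_1; apply: ln_le; lra.
  apply: (@Rle_trans _ (ln (5 * L))); first by apply: ln_le; lra.
  by rewrite ln_mult; [have := @ln_le_sub1 5; rewrite -/y; lra | lra | lra].
apply: (@Rle_trans _ (INR (K ^ B * 2 ^ j))); first by apply: le_INR; apply/leP.
rewrite mult_INR !expn_exp // -exp_plus (_ : INR 2 = 2) //; apply: exp_le.
apply: Rplus_le_compat => //.
by apply: Rmult_le_compat; lra.
Qed.

(** * The mixed moment *)

Lemma prime_of_Z (p : nat) : Znumtheory.prime (Z.of_nat p) -> prime p.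
Proof.
move=> pr; have p1 := prime_ge_2 _ pr.
apply/primeP; split; first by lia.
move=> d /dvdnP [k kE]; apply/orP.
have dv : (Z.of_nat d | Z.of_nat p)%Z by exists (Z.of_nat k); rewrite kE; lia.
by case: (prime_divisors _ pr _ dv) => [h|[h|[h|h]]];
  [lia | left; apply/eqP; lia | right; apply/eqP; lia | lia].
Qed.

Lemma modn_Z (a b : nat) : Z.of_nat (a %% b) = (Z.of_nat a mod Z.of_nat b)%Z.
Proof.
case: b => [|b]; first by rewrite modn0 Zmod_0_r.
apply: (Z.mod_unique_pos _ _ (Z.of_nat (a %/ b.+1))).
  by have := ltn_pmod a (ltn0Sn b); lia.
by have := divn_eq a b.+1; lia.
Qed.

Lemma sum_n_m_C (f : nat -> C) (b : nat) :
  sum_n_m (G := C_AbelianMonoid) f 0 b =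
  (\rsum_(0 <= i < b.+1) (f i).1, \rsum_(0 <= i < b.+1) (f i).2).
Proof.
elim: b => [|b IH]; first by rewrite sum_n_n !big_nat1; case: (f 0%N).
rewrite sum_n_Sm; last by apply: le_0_n.
by rewrite IH [\rsum_(0 <= i < b.+2) (f i).1]big_nat_recr // [\rsum_(0 <= i < b.+2) (f i).2]big_nat_recr.
Qed.

Section Bridge.
Variable p : nat.
Hypothesis p_pr : prime p.
Local Notation F := 'F_p.

Lemma Cexpsum_A (m n : nat) :
  Cmod (Cexpsum (Z.of_nat m) (Z.of_nat n) 5 1 p) ^ 4 = A (m%:R : F)%R n%:R%R ^ 4.
Proof.
have p0 := INR_p_gt0 p_pr.
have phase (a : F) : 2 * PI * ((IZR (Z.of_nat m) * INR a ^ 5 + IZR (Z.of_nat n) * INR a ^ 1) / INR p)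
   = 2 * PI * INR (m * (a * (a * (a * (a * a)))) + n * a)%N / INR p.
  by rewrite -!INR_IZR_INZ plus_INR !mult_INR /=; field; lra.
have phaseF (a : F) : ((m * (a * (a * (a * (a * a)))) + n * a)%N%:R = m%:R * a ^+ 5 + n%:R * a :> F)%R.
  by rewrite natrD !natrM !natr_Fp !exprS expr0 mulr1.
rewrite /Cexpsum sum_n_m_C (_ : (p - 1).+1 = p); last by have := prime_gt0 p_pr; lia.
rewrite (_ : \rsum_(0 <= i < p) _ = A (m%:R : F)%R n%:R%R); last first.
  rewrite rsum_Fp //; apply: eq_bigr => a _; rewrite -phaseF cs_natr //= phase //.
rewrite (_ : \rsum_(0 <= i < p) _ = 0); last first.
  rewrite rsum_Fp // -[RHS](@rsum_odd p (fun a => sn (m%:R * a ^+ 5 + n%:R * a)%R)); last first.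
    by move=> x; rewrite phase_odd snN.
  by apply: eq_bigr => a _; rewrite -phaseF sn_natr //= phase.
set x := A _ _; rewrite /Cmod /=.
have -> : x * (x * 1) + 0 * (0 * 1) = Rsqr x by rewrite /Rsqr; ring.
rewrite sqrt_Rsqr_abs.
have -> : Rabs x * (Rabs x * (Rabs x * (Rabs x * 1))) = (Rabs x ^ 2) ^ 2 by ring.
by rewrite pow2_abs; ring.
Qed.

Lemma saw_Z (z : Z) : saw (IZR z / INR p) = sawF ((Z.to_nat (z mod Z.of_nat p))%:R : F)%R.
Proof.
have p0 := INR_p_gt0 p_pr.
have pz : (0 < Z.of_nat p)%Z by have := prime_gt0 p_pr; lia.
have [r0 r1] := Z.mod_pos_bound z _ pz.
pose q := (z / Z.of_nat p)%Z; pose r := (z mod Z.of_nat p)%Z.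
have zE : IZR z = INR p * IZR q + IZR r.
  by rewrite INR_IZR_INZ -mult_IZR -plus_IZR; congr IZR; apply: Z.div_mod; lia.
have rp : 0 <= IZR r < INR p.
  by rewrite INR_IZR_INZ; split; [apply: IZR_le | apply: IZR_lt].
have x01 : 0 <= IZR r / INR p < 1.
  split; first by apply: Rmult_le_pos; [lra | apply: Rlt_le; apply: Rinv_0_lt_compat].
  by apply/Rlt_div_l => //; lra.
have xE : IZR z / INR p = IZR q + IZR r / INR p by rewrite zE; field; lra.
have fl : Int_part (IZR z / INR p) = q.
  by apply: esym; apply: Int_part_spec; rewrite xE; lra.
have rn : IZR r = INR (Z.to_nat r) by rewrite INR_IZR_INZ Z2Nat.id.
rewrite /saw fl xE /sawF -/r -[0%R]/(0%:R : F)%R eq_natr_Fp // val_natr_Fp // mod0n.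
have rs : (Z.to_nat r < p)%N by rewrite /r; lia.
rewrite modn_small //; case: Req_EM_T => [h|h]; case: eqP => [h'|h'] //.
- have r00 : IZR r = 0.
    have : IZR r / INR p = 0 by lra.
    by move/(f_equal (Rmult (INR p))); have -> : INR p * (IZR r / INR p) = IZR r by [field; lra]; lra.
  by case: h'; rewrite rn in r00; apply: INR_eq.
- by case: h; rewrite rn h' /=; lra.
- by rewrite rn; lra.
Qed.

Lemma dedekind_dedF (h : Z) :
  dedekind h p = dedF ((Z.to_nat (h mod Z.of_nat p))%:R : F)%R.
Proof.
have pz : (0 < Z.of_nat p)%Z by have := prime_gt0 p_pr; lia.
rewrite /dedekind sum_n_m_rsum // (_ : (p - 1).+1 = p); last by have := prime_gt0 p_pr; lia.
rewrite rsum_Fp // /dedF; apply: eq_bigr => a _.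
congr (_ * _).
  rewrite INR_IZR_INZ saw_Z Z.mod_small; last by have := ltn_Fp p_pr a; lia.
  by rewrite Nat2Z.id natr_Fp.
rewrite [INR a]INR_IZR_INZ -mult_IZR saw_Z; congr sawF.
rewrite -{2}(natr_Fp a) -natrM; apply/eqP; rewrite eq_natr_Fp //; apply/eqP.
apply: Nat2Z.inj; rewrite !modn_Z Nat2Z.inj_mul.
have mod_ge0 z : (0 <= z mod Z.of_nat p)%Z by have := Z.mod_pos_bound z _ pz; lia.
by rewrite !Z2Nat.id // Zmod_mod Zmult_mod_idemp_r.
Qed.

Lemma rsum_Fp_nonzero (g : F -> R) :
  \rsum_(1 <= i < p) g i%:R%R = \rsum_(x : F | x != 0%R) g x.
Proof.
have p0 := prime_gt0 p_pr.
have e : \rsum_(0 <= i < p) g i%:R%R = g 0%R + \rsum_(x : F | x != 0%R) g x.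
  by rewrite rsum_Fp // (bigD1 0%R) //=; congr (_ + _); apply: eq_bigr => x _; rewrite natr_Fp.
rewrite big_ltn //= in e.
exact: (Rplus_eq_reg_l _ _ _ e).
Qed.

(** Whatever representatives [inv] selects, m [inv n] is m / n in 'F_p; the substitution m = r n
    then separates [dedF r] from the sum over n. *)
Lemma double_sum_eq (inv : Z -> Z) :
  (forall n : Z, (1 <= n <= Z.of_nat p - 1)%Z -> ((n * inv n) mod Z.of_nat p = 1)%Z) ->
  sum_n_m (G := R_AbelianMonoid)
    (fun m => sum_n_m (G := R_AbelianMonoid)
       (fun n => Cmod (Cexpsum (Z.of_nat m) (Z.of_nat n) 5 1 p) ^ 4
                 * (dedekind (Z.of_nat m * inv (Z.of_nat n)) p) ^ 2)
       1 (p - 1))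
    1 (p - 1) =
  \rsum_(r : F | r != 0%R) (dedF r ^ 2 * Fval r).
Proof.
move=> invP; have p1 := prime_gt1 p_pr.
have ps : (p - 1).+1 = p by lia.
have pz : (0 < Z.of_nat p)%Z by lia.
rewrite sum_n_m_rsum ?ps; last by lia.
transitivity (\rsum_(1 <= m < p) \rsum_(1 <= n < p)
    (A (m%:R : F)%R n%:R%R ^ 4 * dedF (m%:R / n%:R : F)%R ^ 2)).
  rewrite big_nat [RHS]big_nat; apply: eq_bigr => m /andP [m0 mp].
  rewrite sum_n_m_rsum ?ps; last by lia.
  rewrite big_nat [RHS]big_nat; apply: eq_bigr => n /andP [n0 np].
  rewrite Cexpsum_A dedekind_dedF; congr (_ * dedF _ ^ 2).
  have nz : (n%:R != 0 :> F)%R.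
    rewrite -[0%R]/(0%:R : F)%R eq_natr_Fp // mod0n modn_small //.
    by rewrite -lt0n.
  apply: (mulIf nz); rewrite divfK // -natrM; apply/eqP; rewrite eq_natr_Fp //; apply/eqP.
  apply: Nat2Z.inj; rewrite !modn_Z Nat2Z.inj_mul Z2Nat.id; last first.
    by have := Z.mod_pos_bound (Z.of_nat m * inv (Z.of_nat n)) _ pz; lia.
  rewrite Zmult_mod_idemp_l -Z.mul_assoc [(inv _ * _)%Z]Z.mul_comm -Zmult_mod_idemp_r invP; last by lia.
  by rewrite Z.mul_1_r.
under eq_bigr => m _ do rewrite (rsum_Fp_nonzero (fun n => A (m%:R : F)%R n ^ 4 * dedF (m%:R / n)%R ^ 2)).
rewrite (rsum_Fp_nonzero (fun m => \rsum_(n : F | n != 0%R) (A m n ^ 4 * dedF (m / n)%R ^ 2))).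
under [RHS]eq_bigr => r _ do rewrite /Fval -rsum_mull.
rewrite exchange_big [RHS]exchange_big /=; apply: eq_bigr => n n0.
rewrite (reindex_inj (mulIf n0)) /=; apply: eq_big => [r|r _].
  by rewrite mulf_eq0 (negbTE n0) orbF.
by rewrite mulfK // Rmult_comm.
Qed.

End Bridge.

(** Multiplies the two asymptotics through [even_weight_decouples]; the factor D [harm p ^ 3]
    carried by the Dedekind mean square is finally absorbed by [divisor_growth]. *)
Lemma main_estimate : exists K, 0 < K /\ forall p : nat,
  prime p -> (3 < p)%N -> (p %% 4 = 3)%N ->
  Rabs (\rsum_(r : 'F_p | r != 0%R) (dedF r ^ 2 * Fval r) - 5 / 48 * INR p ^ 5) <=
  K * (INR p ^ 4 * exp (3 * ln (INR p) / ln (ln (INR p)))).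
Proof.
have [C [C0 HC]] := divisor_growth; exists (2000 * C); split; first by lra.
move=> p p_pr p_gt3 p_mod4.
have p7 := INR_p_ge7 p_mod4 p_gt3.
have p7' : (7 <= p)%N.
  by apply/leP; apply: INR_le; rewrite (_ : INR 7 = 7) //; rewrite /=; lra.
have [D [D1 [HD growth]]] := HC p p7'.
have pN := p_half p_pr p_gt3.
have counts n : \rsum_(1 <= b < p./2.+1) \rsum_(1 <= c < p./2.+1) ind (n == b * c)%N <= D.
  apply: count_factorizations_le; first by lra.
  move=> k /andP [k0 k1]; apply: HD; rewrite k0 /=; apply: leq_ltn_trans k1 _.
  by rewrite ltn_mul // [X in (_ < X)%N]pN; lia.
have := dedekind_square_rate p_pr p_gt3 D1 counts.
have H1 := harm_ge1 (prime_gt0 p_pr).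
have H2 := harm_le_ln (prime_gt0 p_pr).
pose E := D * harm p ^ 3.
have E1 : 1 <= E.
  by rewrite /E -[1]Rmult_1_l; apply: Rmult_le_compat; try lra; apply: pow_R1_Rle.
have EC : E <= C * exp (3 * ln (INR p) / ln (ln (INR p))).
  apply: Rle_trans growth; apply: Rmult_le_compat_l; first by lra.
  by apply: pow_incr; lra.
have := fourth_moment p_pr p_mod4 p_gt3; rewrite -Fval_total.
have W_even (r : 'F_p) : dedF (- r)%R ^ 2 = dedF r ^ 2.
  have sq x : (- x) ^ 2 = x ^ 2 by ring.
  by rewrite dedF_odd //; apply: sq.
have := even_weight_decouples p_pr p_mod4 p_gt3 W_even.
have -> : \rsum_(r : 'F_p) dedF r ^ 2 = \rsum_(r : 'F_p | r != 0%R) dedF r ^ 2.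
  rewrite (bigD1 0%R) //= (_ : dedF (0%R : 'F_p) = 0); first by rewrite Rmult_0_l Rplus_0_l.
  have odd0 x : x = - x -> x = 0 by lra.
  by apply: odd0; rewrite -dedF_odd // oppr0.
set W := \rsum_(r : 'F_p | _) dedF r ^ 2; set T := \rsum_(r : 'F_p | _) Fval r.
set S := \rsum_(r : 'F_p | _) (_ * _); rewrite -/E.
move=> dec /Rabs_le_between hT /Rabs_le_between hW.
set P := INR p in p7 dec hT hW *.
pose e1 := W - 5 / 144 * P ^ 2; pose e2 := T - 3 * P ^ 4.
have P3 : 0 < P ^ 3 by apply: pow_lt; lra.
have P4 : 0 < P ^ 4 by apply: pow_lt; lra.
have P5 : 0 < P ^ 5 by apply: pow_lt; lra.
have be1 : Rabs e1 <= 3 * P * E by apply: Rabs_le; rewrite /e1; lra.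
have be2 : Rabs e2 <= 2600 * P ^ 3 by apply: Rabs_le; rewrite /e2; lra.
(* The leading product 5/144 P^2 * 3 P^4 is P times 5/48 P^5, so subtracting only P - 1 copies
   leaves the first term. *)
have expand : (P - 1) * (S - 5 / 48 * P ^ 5) =
    5 / 48 * P ^ 5 + 5 / 144 * P ^ 2 * e2 + 3 * P ^ 4 * e1 + e1 * e2.
  by rewrite Rmult_minus_distr_l dec /e1 /e2; field.
have b2 : Rabs (5 / 144 * P ^ 2 * e2) <= 5 / 144 * P ^ 2 * (2600 * P ^ 3).
  rewrite Rabs_mult Rabs_pos_eq; last by nra.
  by apply: Rmult_le_compat_l => //; nra.
have b3 : Rabs (3 * P ^ 4 * e1) <= 3 * P ^ 4 * (3 * P * E).
  rewrite Rabs_mult Rabs_pos_eq; last by lra.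
  by apply: Rmult_le_compat_l => //; lra.
have b4 : Rabs (e1 * e2) <= 3 * P * E * (2600 * P ^ 3).
  by rewrite Rabs_mult; apply: Rmult_le_compat => //; apply: Rabs_pos.
have big : Rabs ((P - 1) * (S - 5 / 48 * P ^ 5)) <= 1300 * (P ^ 5 * E).
  have P5E : P ^ 5 <= P ^ 5 * E by nra.
  have P4E : 7 * (P ^ 4 * E) <= P ^ 5 * E.
    have -> : P ^ 5 * E = P * (P ^ 4 * E) by ring.
    by apply: Rmult_le_compat_r => //; nra.
  have r2 : 5 / 144 * P ^ 2 * (2600 * P ^ 3) = 5 / 144 * 2600 * P ^ 5 by ring.
  have r3 : 3 * P ^ 4 * (3 * P * E) = 9 * (P ^ 5 * E) by ring.
  have r4 : 3 * P * E * (2600 * P ^ 3) = 7800 * (P ^ 4 * E) by ring.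
  rewrite expand; rewrite r2 in b2; rewrite r3 in b3; rewrite r4 in b4.
  move/Rabs_le_between: b2 => b2; move/Rabs_le_between: b3 => b3; move/Rabs_le_between: b4 => b4.
  by apply: Rabs_le; lra.
rewrite Rabs_mult Rabs_pos_eq in big; last by lra.
(* Dividing by P - 1 costs 1300 P <= 2000 (P - 1), valid for P >= 7. *)
have key : Rabs (S - 5 / 48 * P ^ 5) <= 2000 * (P ^ 4 * E).
  apply: (Rmult_le_reg_l (P - 1)); first by lra.
  apply: Rle_trans big _.
  have -> : 1300 * (P ^ 5 * E) = 1300 * P * (P ^ 4 * E) by ring.
  have -> : (P - 1) * (2000 * (P ^ 4 * E)) = 2000 * (P - 1) * (P ^ 4 * E) by ring.
  by apply: Rmult_le_compat_r; nra.
apply: Rle_trans key _.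
have -> : 2000 * C * (P ^ 4 * exp (3 * ln P / ln (ln P))) =
   2000 * (P ^ 4 * (C * exp (3 * ln P / ln (ln P)))) by ring.
apply: Rmult_le_compat_l; first by lra.
by apply: Rmult_le_compat_l => //; lra.
Qed.

Lemma modn_modulo (a b : nat) : (0 < b)%N -> (a %% b)%N = Nat.modulo a b.
Proof.
move=> b0; apply: (Nat.mod_unique _ _ (a %/ b)); first by apply/ltP; rewrite ltn_mod.
by rewrite {1}(divn_eq a b); lia.
Qed.

Lemma ltn_of_lt (a b : nat) : lt a b -> (a < b)%N.
Proof. by move/ltP. Qed.

End DedekindMoment.

Theorem theorem1p2 :
  exists K : R, 0 < K /\
  forall p : nat,
    prime (Z.of_nat p) -> (3 < p)%nat -> (p mod 4 = 3)%nat ->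
    forall inv : Z -> Z,
      (forall n : Z, (1 <= n <= Z.of_nat p - 1)%Z ->
         ((n * inv n) mod Z.of_nat p = 1)%Z) ->
      Rabs (sum_n_m (G := R_AbelianMonoid)
              (fun m => sum_n_m (G := R_AbelianMonoid)
                 (fun n => Cmod (Cexpsum (Z.of_nat m) (Z.of_nat n) 5 1 p) ^ 4
                           * (dedekind (Z.of_nat m * inv (Z.of_nat n)) p) ^ 2)
                 1 (p - 1))
              1 (p - 1)
            - 5 / 48 * INR p ^ 5)
      <= K * (INR p ^ 4 * exp (3 * ln (INR p) / ln (ln (INR p)))).
Proof.
destruct DedekindMoment.main_estimate as [K [K0 HK]].
exists K; split; [exact K0 | intros p pr p3 p4 inv hinv].
pose proof (DedekindMoment.prime_of_Z pr) as pr'.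
refine (eq_ind_r (fun s => Rabs (s - 5 / 48 * INR p ^ 5) <= _) _
  (DedekindMoment.double_sum_eq pr' hinv)).
apply HK.
- exact pr'.
- exact (DedekindMoment.ltn_of_lt p3).
- rewrite DedekindMoment.modn_modulo; [exact p4 | reflexivity].
Qed.
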